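(* Let $e$ be a positive integer and let $\mu,\nu\in\mathring P^+$ lie in the same orbit of $W_e$ under the dot action. Then $$\mu\uparrow_e\nu\iff f(\mu)\le_e f(\nu).$$
   Context: $\mathring\Phi$ is an irreducible finite root system with positive roots $\mathring\Phi^+$, weight lattice $\mathring P$, dominant weights $\mathring P^+$, root lattice $\mathring Q$, Weyl group $\mathring W$, half-sum of positive roots $\mathring\rho$. $W_e=\mathring W\ltimes e\mathring Q$ acts on $\mathbb R\mathring P$ by $w\cdot x=w(x+\mathring\rho)-\mathring\rho$ for $w\in\mathring W$, and by translations for $e\mathring Q$. The standard (dominant) alcove is $C=\{x\in\mathbb R\mathring P:0<\langle x+\mathring\rho,\alpha^\vee\rangle<e\ \text{for all }\alpha\in\mathring\Phi^+\}$, with closure $\overline C$. $W_e$ is a Coxeter group generated by the reflections in the walls of $C$; $l_e$ and $\le_e$ denote the length function and the Bruhat-Chevalley order with respect to these generators. For $\mu\in\mathring P^+$, $f(\mu)$ is the unique element $f\in W_e$ with $l_e(f)$ minimal such that $f\cdot x=\mu$ for some $x\in\overline C$. For $\mu,\nu\in\mathring P$, $\mu\uparrow_e\nu$ means that $\mu=\nu$ or there are weights $\mu=\mu_0\le\mu_1\le\cdots\le\mu_m=\nu$ in $\mathring P$ (where $\le$ is the dominance order: $\xi\le\eta$ iff $\eta-\xi$ is a nonnegative integer combination of positive roots) and reflections $s_1,\dots,s_m\in W_e$ (not necessarily fundamental) such that $s_i\cdot\mu_{i-1}=\mu_i$ for $i=1,\dots,m$. *)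

(* Defs.v *)
From HB Require Import structures.
From mathcomp Require Import all_boot all_order all_algebra.
From mathcomp Require Import all_classical all_reals all_analysis.
From Stdlib Require Import Relation_Operators.

Set Implicit Arguments.
Unset Strict Implicit.
Unset Printing Implicit Defensive.

Import Order.TTheory GRing.Theory Num.Theory.
Import numFieldNormedType.Exports.
Local Open Scope classical_set_scope.
Local Open Scope ring_scope.

Section RootSystem.
Context {R : realType} {n : nat}.
Implicit Types (x y a b : 'cV[R]_n) (Phi Delta S : seq 'cV[R]_n).

Definition dot x y : R := \sum_(i < n) x i 0 * y i 0.

Definition coroot a : 'cV[R]_n := (2 / dot a a) *: a.

Definition pairing x a : R := dot x (coroot a).

(* refl a *m x = x - pairing x a *: a *)
Definition refl a : 'M[R]_n := 1%:M - a *m (coroot a)^T.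

(* Reduced root systems in the Euclidean space R^n. The roots span R^n, so that
   the real span of the weight lattice is all of R^n. *)
Definition root_system Phi : Prop :=
  [/\ uniq Phi, 0 \notin Phi & <<Phi>>%VS = fullv] /\
  [/\ forall a b, a \in Phi -> b \in Phi -> refl a *m b \in Phi,
      forall a b, a \in Phi -> b \in Phi -> pairing b a \is a Num.int
    & forall a (c : R), a \in Phi -> c *: a \in Phi -> c = 1 \/ c = -1].

Definition irreducible_roots Phi : Prop :=
  Phi <> [::] /\
  ~ exists p : pred 'cV[R]_n,
      [/\ exists2 a, a \in Phi & p a,
          exists2 b, b \in Phi & ~~ p b
        & forall a b, a \in Phi -> b \in Phi -> p a -> ~~ p b -> dot a b = 0].

Definition nat_comb S x : Prop :=
  exists c : 'cV[R]_n -> nat, x = \sum_(a <- S) a *+ c a.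

Definition int_comb S x : Prop :=
  exists c : 'cV[R]_n -> int, x = \sum_(a <- S) a *~ c a.

Definition is_base Phi Delta : Prop :=
  [/\ {subset Delta <= Phi}, basis_of fullv Delta
    & forall a, a \in Phi -> nat_comb Delta a \/ nat_comb Delta (- a)].

Definition pos_roots Phi Delta : seq 'cV[R]_n :=
  [seq a <- Phi | `[< nat_comb Delta a >]].

Definition half_sum Phi Delta : 'cV[R]_n :=
  2^-1 *: \sum_(a <- pos_roots Phi Delta) a.

Definition weight Phi x : Prop :=
  forall a, a \in Phi -> pairing x a \is a Num.int.

Definition dominant_weight Phi Delta x : Prop :=
  weight Phi x /\ forall a, a \in pos_roots Phi Delta -> 0 <= pairing x a.

Definition dominance Phi Delta x y : Prop :=
  nat_comb (pos_roots Phi Delta) (y - x).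

Definition weyl Phi (w : 'M[R]_n) : Prop :=
  exists2 s : seq 'cV[R]_n,
    {subset s <= Phi} & w = \big[mulmx/1%:M]_(a <- s) refl a.

End RootSystem.

Section AffineWeylGroup.
Context {R : realType} {n : nat}.
Variables (Phi Delta : seq 'cV[R]_n) (e : nat).
Implicit Types (x y a b : 'cV[R]_n) (k m : int).

(* Elements of the semidirect product of the Weyl group with e times the root
   lattice: (w, t) stands for w followed by the translation by t. *)
Local Notation affine := ('M[R]_n * 'cV[R]_n)%type.
Implicit Types (g h u v s t : affine).

Definition aone : affine := (1%:M, 0).
Definition amul g h : affine := (g.1 *m h.1, g.1 *m h.2 + g.2).
Definition ainv g : affine := (invmx g.1, - (invmx g.1 *m g.2)).

Definition affine_weyl g : Prop :=
  weyl Phi g.1 /\ exists2 q, int_comb Phi q & g.2 = e%:R *: q.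

Definition dot_act g x : 'cV[R]_n :=
  g.1 *m (x + half_sum Phi Delta) - half_sum Phi Delta + g.2.

Definition alcove : set 'cV[R]_n :=
  [set x | forall a, a \in pos_roots Phi Delta ->
     0 < pairing (x + half_sum Phi Delta) a < e%:R].

Definition hyperplane a k : set 'cV[R]_n :=
  [set x | pairing (x + half_sum Phi Delta) a = k%:~R * e%:R].

(* Under [dot_act], the orthogonal reflection in [hyperplane a k]. *)
Definition affine_refl a k : affine := (refl a, (k%:~R * e%:R) *: a).

(* A wall of the alcove is the support of one of its codimension-one faces,
   i.e. the only reflecting hyperplane through some point of the closure. *)
Definition is_wall a k : Prop :=
  exists2 x, closure alcove x /\ hyperplane a k x &
    forall b m, b \in Phi -> hyperplane b m x ->
      hyperplane b m = hyperplane a k.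

Definition fundamental s : Prop :=
  exists a k, [/\ a \in Phi, is_wall a k & s = affine_refl a k].

Definition reflection t : Prop :=
  exists h s, [/\ affine_weyl h, fundamental s & t = amul (amul h s) (ainv h)].

Definition expression g (l : seq affine) : Prop :=
  (forall s, s \in l -> fundamental s) /\ g = foldr amul aone l.

Definition len g : nat :=
  xget 0%N [set k : nat | (exists2 l, expression g l & size l = k) /\
                          forall l, expression g l -> (k <= size l)%N].

Definition bruhat : affine -> affine -> Prop :=
  clos_refl_trans affine (fun u v =>
    exists2 t, reflection t & v = amul u t /\ (len u < len v)%N).

Definition moves_to mu g : Prop :=
  affine_weyl g /\ exists2 x, closure alcove x & dot_act g x = mu.

Definition minimal_mover mu : affine :=
  xget aone [set g | moves_to mu g /\
                     forall h, moves_to mu h -> (len g <= len h)%N].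

Definition linked_up : 'cV[R]_n -> 'cV[R]_n -> Prop :=
  clos_refl_trans 'cV[R]_n (fun x y =>
    [/\ weight Phi x, weight Phi y, dominance Phi Delta x y
      & exists2 s, reflection s & dot_act s x = y]).

Definition same_orbit x y : Prop :=
  exists2 g, affine_weyl g & dot_act g x = y.

End AffineWeylGroup.

(* Main.v *)
Require Import Defs.
From HB Require Import structures.
From mathcomp Require Import all_boot all_order all_algebra.
From mathcomp Require Import all_classical all_reals all_analysis.
From mathcomp Require Import ring lra zify.
From Stdlib Require Import Relation_Operators.

Set Implicit Arguments.
Unset Strict Implicit.
Unset Printing Implicit Defensive.

Import Order.TTheory GRing.Theory Num.Theory.
Import numFieldNormedType.Exports.
Local Open Scope ring_scope.

(** After the shift by the half-sum [rho] of the positive roots, the dot action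
    is an ordinary affine action. Fix a point [p] of the closed alcove in the
    common orbit of [mu] and [nu], so that both weights are images of [p]. A
    reflection step [x |-> s x] that moves [x] up comes from a step
    [g |-> s g] in the affine Weyl group, where [x] is the image of [p] under
    [g]; the step goes up when the alcove of [g] lies on the negative side of
    the hyperplane of [s], with respect to the positive root. A step of the
    Bruhat order has the same form, but there the hyperplane must have the alcove
    of [g] and the fundamental alcove on the same side. Both orders are thus
    generated by reflections in oriented hyperplanes, and only the orientation
    differs: by positive roots ([positive]), or away from the fundamental alcove
    ([away]). The two orientations agree on all hyperplanes that meet the open
    dominant chamber ([dominant_side_away]). Since [mu + rho] is strictly
    dominant, every alcove with [mu + rho] in its closure is dominant; but the
    alcoves inside a chain need not be.

    The lifting property ([lift_low], [lift_down], [lift_up]) holds for every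
    orientation: multiplying a step on the right by the reflection in a wall
    gives again a step, except when the two alcoves of the step are adjacent
    through that wall ([right_homo]). For the orientation away from the alcove it
    also holds on the left.

    From Bruhat to linkage ([bruhat_linkage]): induct on the length of the larger
    element [v]. A right descent of [v] leads to a dominant alcove, one step
    below [v] in both orders; the lifting property in the Bruhat order allows the
    induction, and the lifting property in the linkage order leads back.

    From linkage to Bruhat ([linkage_bruhat]): the linkage order is invariant
    under translations, so a whole chain can be pushed into the dominant chamber
    by a dominant translation; there it is a Bruhat chain. The translation is
    cancelled on the left ([left_cancel]), because its length adds to that of a
    dominant alcove. The chain leads from the minimal mover of [mu] to some
    element that differs from the minimal mover of [nu] by an element of the
    stabilizer of [p]. This stabilizer is generated by reflections in walls through [p]
    ([stabilizer_expression]), and descending in the coset keeps the inequality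
    ([below_coset]).

    The Coxeter theory that this uses (generation by the reflections in the
    walls, the deletion property, the closed alcove as a fundamental domain)
    rests on two facts. A hyperplane separating adjacent alcoves is their common
    wall ([wall_separation]); and a point outside the closed alcove is separated
    from it by some wall ([wall_exists]). *)

(** * Scalar product and reflections *)

Section Euclidean.
Context {R : realType} {n : nat}.
Implicit Types (x y z a b : 'cV[R]_n) (c : R) (A : 'M[R]_n).

Lemma dotE x y : dot x y = (x^T *m y) 0 0.
Proof. by rewrite mxE; apply: eq_bigr => i _; rewrite mxE. Qed.

Lemma dotC x y : dot x y = dot y x.
Proof. by apply: eq_bigr => i _; rewrite mulrC. Qed.

Lemma dotDr x y z : dot x (y + z) = dot x y + dot x z.
Proof. by rewrite !dotE mulmxDr mxE. Qed.

Lemma dotZr c x y : dot x (c *: y) = c * dot x y.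
Proof. by rewrite !dotE -scalemxAr mxE. Qed.

Lemma dotDl x y z : dot (x + y) z = dot x z + dot y z.
Proof. by rewrite dotC dotDr !(dotC z). Qed.

Lemma dotZl c x y : dot (c *: x) y = c * dot x y.
Proof. by rewrite dotC dotZr dotC. Qed.

Lemma dotNl x y : dot (- x) y = - dot x y.
Proof. by rewrite -scaleN1r dotZl mulN1r. Qed.

Lemma dotNr x y : dot x (- y) = - dot x y.
Proof. by rewrite dotC dotNl dotC. Qed.

Lemma dotBl x y z : dot (x - y) z = dot x z - dot y z.
Proof. by rewrite dotDl dotNl. Qed.

Lemma dot0l x : dot 0 x = 0.
Proof. by rewrite -(scale0r 0) dotZl mul0r. Qed.

Lemma dot_suml (I : Type) (r : seq I) (f : I -> 'cV[R]_n) y :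
  dot (\sum_(i <- r) f i) y = \sum_(i <- r) dot (f i) y.
Proof.
elim/big_rec2: _ => [|i u v _ <-]; first exact: dot0l.
by rewrite dotDl.
Qed.

Lemma dot_mulmx A x y : dot (A *m x) y = dot x (A^T *m y).
Proof. by rewrite !dotE trmx_mul mulmxA. Qed.

Lemma dot_ge0 x : 0 <= dot x x.
Proof. by apply: sumr_ge0 => i _; rewrite -expr2 sqr_ge0. Qed.

Lemma dot_eq0 x : (dot x x == 0) = (x == 0).
Proof.
apply/eqP/eqP => [x0|->]; last exact: dot0l.
apply/colP => i; rewrite mxE; apply/eqP; rewrite -sqrf_eq0 expr2.
apply/eqP; apply: (psumr_eq0P _ x0) => // j _.
by rewrite -expr2 sqr_ge0.
Qed.

Lemma dot_gt0 x : (0 < dot x x) = (x != 0).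
Proof. by rewrite lt_neqAle dot_ge0 andbT eq_sym dot_eq0. Qed.

Lemma pairingE x a : pairing x a = 2 / dot a a * dot x a.
Proof. by rewrite /pairing /coroot dotZr. Qed.

Lemma pairingDl x y a : pairing (x + y) a = pairing x a + pairing y a.
Proof. exact: dotDl. Qed.

Lemma pairingBl x y a : pairing (x - y) a = pairing x a - pairing y a.
Proof. exact: dotBl. Qed.

Lemma pairingZl c x a : pairing (c *: x) a = c * pairing x a.
Proof. exact: dotZl. Qed.

Lemma pairingNr x a : pairing x (- a) = - pairing x a.
Proof. by rewrite !pairingE dotNl !dotNr opprK mulrN. Qed.

Lemma pairing_sum (I : Type) (r : seq I) (f : I -> 'cV[R]_n) a :
  pairing (\sum_(i <- r) f i) a = \sum_(i <- r) pairing (f i) a.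
Proof. exact: dot_suml. Qed.

Lemma pairing_self a : a != 0 -> pairing a a = 2.
Proof. by rewrite -dot_gt0 pairingE => /lt0r_neq0 a0; rewrite divfK. Qed.

Lemma pairing_gt0 x a : a != 0 -> (0 < pairing x a) = (0 < dot x a).
Proof.
rewrite -dot_gt0 pairingE => a0.
by rewrite pmulr_rgt0 // divr_gt0.
Qed.

Lemma reflE a x : refl a *m x = x - pairing x a *: a.
Proof.
rewrite /refl mulmxBl mul1mx -mulmxA [_^T *m x]mx11_scalar -dotE dotC.
by rewrite mul_mx_scalar.
Qed.

Lemma refl_tr a : (refl a)^T = refl a.
Proof.
by rewrite /refl linearB /= trmx1 trmx_mul trmxK /coroot linearZ /= -scalemxAl -scalemxAr.
Qed.

Lemma refl_self a : a != 0 -> refl a *m a = - a.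
Proof.
by move=> a0; rewrite reflE pairing_self // scaler_nat mulr2n opprD addrA subrr sub0r.
Qed.

Lemma mx_ext (A B : 'M[R]_n) : (forall x, A *m x = B *m x) -> A = B.
Proof.
move=> AB; apply/matrixP => i j; have := AB (delta_mx j 0).
by rewrite -!colE => /matrixP/(_ i 0); rewrite !mxE.
Qed.

Lemma reflK a : a != 0 -> refl a *m refl a = 1%:M.
Proof.
move=> a0; apply: mx_ext => x; rewrite -mulmxA mul1mx [refl a *m x]reflE.
rewrite mulmxBr -scalemxAr refl_self // reflE scalerN opprK.
by rewrite subrK.
Qed.

Lemma dot_orth A x y : A^T *m A = 1%:M -> dot (A *m x) (A *m y) = dot x y.
Proof. by move=> AA; rewrite dot_mulmx mulmxA AA mul1mx. Qed.

Lemma pairing_orth A x a : A^T *m A = 1%:M -> pairing (A *m x) (A *m a) = pairing x a.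
Proof. by move=> AA; rewrite !pairingE !dot_orth. Qed.

(** The component of [b] orthogonal to [a] lies in both kernels, so it is
    orthogonal to itself. *)
Lemma same_kernel a b : a != 0 ->
  (forall d, dot d a = 0 -> dot d b = 0) -> b = (dot b a / dot a a) *: a.
Proof.
move=> a0 ker; apply/eqP; rewrite -subr_eq0 -dot_eq0; apply/eqP.
set c := _ / _; have d0 : dot (b - c *: a) a = 0.
  by rewrite dotBl dotZl divfK ?subrr // dot_eq0.
by rewrite dotDr ker // dotNr dotZr d0 mulr0 subrr.
Qed.

End Euclidean.

(** * Combinations of roots *)

Section Combinations.
Context {R : realType} {n : nat}.
Implicit Types (S : seq 'cV[R]_n) (x y a : 'cV[R]_n).

Lemma nat_comb0 S : nat_comb S 0.
Proof. by exists (fun=> 0%N); rewrite big1. Qed.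

Lemma nat_combD S x y : nat_comb S x -> nat_comb S y -> nat_comb S (x + y).
Proof.
move=> [c ->] [d ->]; exists (fun a => c a + d a)%N.
by rewrite -big_split; apply: eq_bigr => a _; rewrite mulrnDr.
Qed.

Lemma nat_comb_mem S a : uniq S -> a \in S -> nat_comb S a.
Proof.
move=> uS aS; exists (fun b => (b == a) : nat).
rewrite (bigD1_seq a) //= eqxx big1 ?addr0 // => b /negPf ->.
exact: mulr0n.
Qed.

Lemma nat_combMn S x k : nat_comb S x -> nat_comb S (x *+ k).
Proof.
move=> Sx; elim: k => [|k IH]; first exact: nat_comb0.
by rewrite mulrS; exact: nat_combD.
Qed.

Lemma int_comb0 S : int_comb S 0.
Proof. by exists (fun=> 0); rewrite big1 // => a _; rewrite mulr0z. Qed.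

Lemma int_combD S x y : int_comb S x -> int_comb S y -> int_comb S (x + y).
Proof.
move=> [c ->] [d ->]; exists (fun a => c a + d a).
by rewrite -big_split; apply: eq_bigr => a _; rewrite mulrzDr.
Qed.

Lemma int_combN S x : int_comb S x -> int_comb S (- x).
Proof.
move=> [c ->]; exists (fun a => - c a).
by rewrite -sumrN; apply: eq_bigr => a _; rewrite mulrNz.
Qed.

Lemma int_combB S x y : int_comb S x -> int_comb S y -> int_comb S (x - y).
Proof. by move=> Sx /int_combN; exact: int_combD. Qed.

Lemma int_comb_mem S a : uniq S -> a \in S -> int_comb S a.
Proof.
move=> uS aS; exists (fun b => (b == a)%:R).
rewrite (bigD1_seq a) //= eqxx big1 ?addr0 ?mulr1z // => b /negPf ->.
exact: mulr0z.
Qed.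

Lemma int_combMz S x k : int_comb S x -> int_comb S (x *~ k).
Proof.
move=> [c ->]; exists (fun a => c a * k).
by rewrite mulrz_suml; apply: eq_bigr => a _; rewrite mulrzA.
Qed.

Lemma int_comb_sum S (I : eqType) (r : seq I) (P : pred I) (f : I -> 'cV[R]_n) :
  (forall i, i \in r -> P i -> int_comb S (f i)) ->
  int_comb S (\sum_(i <- r | P i) f i).
Proof.
move=> Sf; rewrite big_seq_cond; elim/big_rec: _ => [|i x /andP[ir Pi] Sx].
  exact: int_comb0.
by apply: int_combD => //; exact: Sf.
Qed.

End Combinations.

(** * Affine maps *)

Section AffineGroup.
Context {R : realType} {n : nat}.
Local Notation affine := ('M[R]_n * 'cV[R]_n)%type.
Implicit Types (x y a b : 'cV[R]_n) (g h : affine).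

Definition act g x : 'cV[R]_n := g.1 *m x + g.2.

Lemma act_mul g h x : act (amul g h) x = act g (act h x).
Proof. by rewrite /act /= mulmxDr mulmxA addrA. Qed.

Lemma act1 x : act aone x = x.
Proof. by rewrite /act /= mul1mx addr0. Qed.

Lemma affine_ext g h : (forall x, act g x = act h x) -> g = h.
Proof.
case: g h => [A u] [B v]; rewrite /act /= => E.
have uv : u = v by have := E 0; rewrite !mulmx0 !add0r.
by congr pair => //; apply: mx_ext => x; have := E x; rewrite uv => /addIr.
Qed.

Lemma amulA g h f : amul g (amul h f) = amul (amul g h) f.
Proof. by apply: affine_ext => x; rewrite !act_mul. Qed.

Lemma amul1g g : amul aone g = g.
Proof. by apply: affine_ext => x; rewrite act_mul act1. Qed.

Lemma amulg1 g : amul g aone = g.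
Proof. by apply: affine_ext => x; rewrite act_mul act1. Qed.

End AffineGroup.

(** * Minima and small perturbations of finite families *)

Lemma seq_argmin {R : realType} {T : eqType} (f : T -> R) (s : seq T) : s != [::] ->
  exists2 m, m \in s & forall z, z \in s -> f m <= f z.
Proof.
elim: s => [//|x s IH] _; have [->|/IH[m ms mP]] := eqVneq s [::].
  by exists x; rewrite ?mem_head // => z; rewrite inE => /eqP ->.
have [xm|mx] := leP (f x) (f m).
  exists x; rewrite ?mem_head // => z; rewrite inE => /orP[/eqP -> //|/mP].
  exact: le_trans.
exists m; rewrite ?inE ?ms ?orbT // => z; rewrite inE => /orP[/eqP ->|/mP //].
exact: ltW.
Qed.

(** Strict inequalities between values at [0] of finitely many affine functions
    of one variable persist at some positive argument. *)
Lemma small_perturbation {R : realType} (s : seq (R * R)) :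
  (forall pq, pq \in s -> 0 < pq.1) ->
  exists2 eps, 0 < eps & forall pq, pq \in s -> 0 < pq.1 + eps * pq.2.
Proof.
suff H : (forall pq, pq \in s -> 0 < pq.1) ->
    exists2 eps, 0 < eps & forall t, 0 < t -> t <= eps ->
      forall pq, pq \in s -> 0 < pq.1 + t * pq.2.
  by move=> /H[eps e0 eP]; exists eps => // pq; exact: eP.
elim: s => [|[p q] s IH] sP; first by exists 1.
have [|eps e0 eP] := IH; first by move=> pq qs; apply: sP; rewrite inE qs orbT.
have p0 : 0 < p by have := sP _ (mem_head _ _).
have q1 : 0 < 1 + `|q| by rewrite ltr_pwDl.
exists (Num.min eps (p / (1 + `|q|))); first by rewrite lt_min e0 divr_gt0.
move=> t t0; rewrite le_min => /andP[te tp] pq; rewrite inE.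
move=> /orP[/eqP -> /=|]; last exact: eP.
move: tp; rewrite ler_pdivlMr // => tp.
have := ler_norm (- q); rewrite normrN => nq.
have : t * - q <= t * `|q| by rewrite ler_pM2l.
by rewrite mulrN; lra.
Qed.

(** * Lifting along an involution *)

(** Let an involution [f] preserve the steps of [E], except those that join a
    point to its image, and let each point be joined to its image by a step in one
    of the two directions. Then the maps that send [x] to the lower (or to the
    upper) of [x] and [f x] are monotone for the generated order. No antisymmetry
    is involved, so the lower point need not be unique; when both directions
    occur, the definitions below choose [x] as the lower one. *)
Section Lifting.
Context {T : Type} (E : T -> T -> Prop) (D : T -> Prop) (f : T -> T).
Hypotheses (E_dom : forall x y, D x -> E x y -> D y)
  (f_total : forall x, D x -> E x (f x) \/ E (f x) x)
  (f_homo : forall x y, D x -> E x y -> E (f x) (f y) \/ y = f x)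
  (fK : involutive f).
Local Notation le := (clos_refl_trans T E).

Let lower x := `[< E x (f x) >].
Let fmin x := if lower x then x else f x.
Let fmax x := if lower x then f x else x.

Lemma le_dom x y : le x y -> D x -> D y.
Proof. by elim=> [u v uv Du| |u v w _ uv _ vw /uv/vw] //; exact: E_dom uv. Qed.

Let not_lower x : D x -> ~ E x (f x) -> E (f x) x.
Proof. by move=> Dx n; case: (f_total Dx). Qed.

Let fmin_fmax_homo x y : le x y -> D x -> le (fmin x) (fmin y) /\ le (fmax x) (fmax y).
Proof.
elim=> {x y} [x y xy Dx|x Dx|x y z xy IHxy _ IHyz Dx].
- have Dy := E_dom Dx xy; rewrite /fmin /fmax /lower.
  have [fxy|yE] := f_homo Dx xy.
    case: asboolP => [xf|/(not_lower Dx) fx]; case: asboolP => [yf|/(not_lower Dy) fy].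
    + by split; exact: rt_step.
    + by split; (apply: rt_trans (rt_step _ _ _ _ _) (rt_step _ _ _ _ _); last first); eassumption.
    + by split; [apply: rt_trans (rt_step _ _ _ _ fx) (rt_step _ _ _ _ xy)|
                 apply: rt_trans (rt_step _ _ _ _ xy) (rt_step _ _ _ _ yf)].
    + by split; exact: rt_step.
  rewrite yE fK in xy *; case: asboolP => // _; case: asboolP => [fx|_].
    by split; exact: rt_step.
  by split; exact: rt_refl.
- by split; exact: rt_refl.
- have [m1 M1] := IHxy Dx; have [m2 M2] := IHyz (le_dom xy Dx).
  by split; [exact: rt_trans m1 m2|exact: rt_trans M1 M2].
Qed.

Let fmin_le x : D x -> le (fmin x) (f x).
Proof.
rewrite /fmin /lower => Dx; case: asboolP => [xf|_]; last exact: rt_refl.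
exact: rt_step.
Qed.

Lemma lift_low x y : le x y -> D x -> E x (f x) -> le x (f y).
Proof.
move=> xy Dx xf; have [m _] := fmin_fmax_homo xy Dx.
have -> : x = fmin x by rewrite /fmin /lower asboolT.
exact: rt_trans m (fmin_le (le_dom xy Dx)).
Qed.

Lemma lift_down x y : le x y -> D x -> E (f x) x -> le (f x) (f y).
Proof.
move=> xy Dx fx; have [m _] := fmin_fmax_homo xy Dx.
have fm : le (f x) (fmin x).
  by rewrite /fmin; case: ifP => _; [exact: rt_step|exact: rt_refl].
exact: rt_trans fm (rt_trans _ _ _ _ _ m (fmin_le (le_dom xy Dx))).
Qed.

Lemma lift_up x y : le x y -> D x -> E y (f y) -> le (f x) (f y).
Proof.
move=> xy Dx yf; have [_ M] := fmin_fmax_homo xy Dx.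
have -> : f y = fmax y by rewrite /fmax /lower asboolT.
apply: rt_trans M; rewrite /fmax /lower.
by case: asboolP => [_|/(not_lower Dx) fx]; [exact: rt_refl|exact: rt_step].
Qed.

End Lifting.

Section AffineWeylGroup.
Context {R : realType} {n : nat} {Phi Delta : seq 'cV[R]_n} {e : nat}.
Hypotheses (hPhi : root_system Phi) (hDelta : is_base Phi Delta) (e_gt0 : (0 < e)%N).
Local Notation affine := ('M[R]_n * 'cV[R]_n)%type.
Local Notation aroot := ('cV[R]_n * int)%type.
Local Notation W := (affine_weyl Phi e).
Local Notation pos := (pos_roots Phi Delta).
Local Notation rho := (half_sum Phi Delta).
Local Notation fundamental := (fundamental Phi Delta e).
Local Notation expression := (expression Phi Delta e).
Local Notation len := (len Phi Delta e).
Local Notation moves_to := (moves_to Phi Delta e).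
Implicit Types (x y a b : 'cV[R]_n) (A : 'M[R]_n) (al be : aroot).
Implicit Types (g h s u v w : affine) (l : seq affine).

Let eR : 0 < e%:R :> R.
Proof. by rewrite ltr0n. Qed.

Let e0 : e%:R != 0 :> R.
Proof. exact: lt0r_neq0. Qed.

(** * Positive roots and their half-sum *)

Local Notation cf j := (coord (in_tuple Delta) j).

Lemma root_uniq : uniq Phi.
Proof. by have [[]] := hPhi. Qed.

Lemma root_neq0 a : a \in Phi -> a != 0.
Proof. by have [[_ h0 _] _] := hPhi; apply: contraTneq => ->. Qed.

Lemma root_refl a b : a \in Phi -> b \in Phi -> refl a *m b \in Phi.
Proof. by have [_ [h _ _]] := hPhi; exact: h. Qed.

Lemma root_int a b : a \in Phi -> b \in Phi -> pairing b a \is a Num.int.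
Proof. by have [_ [_ h _]] := hPhi; exact: h. Qed.

Lemma root_reduced a c : a \in Phi -> c *: a \in Phi -> c = 1 \/ c = -1.
Proof. by have [_ [_ _ h]] := hPhi; exact: h. Qed.

Lemma root_opp a : a \in Phi -> - a \in Phi.
Proof. by move=> ra; rewrite -refl_self ?root_neq0 //; exact: root_refl. Qed.

Lemma base_free : free Delta.
Proof. by have [_ /basis_free] := hDelta. Qed.

Lemma base_uniq : uniq Delta.
Proof. exact/free_uniq/base_free. Qed.

Lemma base_root a : a \in Delta -> a \in Phi.
Proof. by have [h _ _] := hDelta; exact: h. Qed.

Lemma coord_expand x : x = \sum_(j < size Delta) cf j x *: Delta`_j.
Proof.
have [_ bD _] := hDelta.
by apply: (@coord_basis _ _ fullv _ (in_tuple Delta)); rewrite ?memvf.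
Qed.

Lemma coord_nat_comb x j : nat_comb Delta x -> cf j x \is a Num.nat.
Proof.
move=> [c ->]; rewrite (big_nth 0) big_mkord.
under eq_bigr => i _ do rewrite -scaler_nat.
by rewrite (@coord_sum_free _ _ _ (in_tuple Delta)) ?base_free // natr_nat.
Qed.

Lemma nat_comb_coord S x : uniq S -> {subset Delta <= S} ->
  (forall j, cf j x \is a Num.nat) -> nat_comb S x.
Proof.
move=> uS sub cx; rewrite (coord_expand x).
elim/big_rec: _ => [|j y _ Sy]; first exact: nat_comb0.
have /natrP[k ->] := cx j; apply: nat_combD => //; rewrite scaler_nat.
by apply: nat_combMn; apply: nat_comb_mem => //; apply/sub/mem_nth.
Qed.

Lemma coord_int_comb x j : int_comb Phi x -> cf j x \is a Num.int.
Proof.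
have [_ _ dich] := hDelta.
move=> [c ->]; rewrite raddf_sum /= big_seq rpred_sum // => a ra.
rewrite raddfMz rpredMz //; have [/coord_nat_comb|/coord_nat_comb] := dich _ ra.
  by move/(_ j)/intr_nat.
by move/(_ j)/intr_nat; rewrite linearN rpredN.
Qed.

Lemma mem_pos a : (a \in pos) <-> a \in Phi /\ nat_comb Delta a.
Proof.
rewrite mem_filter; split=> [/andP[/asboolP]|[-> /asboolP ->]] //.
Qed.

Lemma pos_root a : a \in pos -> a \in Phi.
Proof. by case/mem_pos. Qed.

Lemma pos_uniq : uniq pos.
Proof. exact/filter_uniq/root_uniq. Qed.

Lemma base_pos a : a \in Delta -> a \in pos.
Proof.
move=> aD; apply/mem_pos; split; first exact: base_root.
exact: nat_comb_mem base_uniq aD.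
Qed.

Lemma pos_total a : a \in Phi -> a \in pos \/ - a \in pos.
Proof.
have [_ _ dich] := hDelta.
move=> ra; have [ca|ca] := dich _ ra; [left|right]; apply/mem_pos => //.
by split=> //; exact: root_opp.
Qed.

Lemma pos_opp a : a \in pos -> - a \notin pos.
Proof.
move=> /mem_pos[ra ca]; apply/negP => /mem_pos[_ cNa].
have := root_neq0 ra; rewrite (coord_expand a) big1 ?eqxx // => j _.
have /natr_ge0 := coord_nat_comb j ca; have /natr_ge0 := coord_nat_comb j cNa.
rewrite linearN oppr_ge0 => le0 ge0.
by rewrite (@le_anti _ _ (cf j a) 0) ?scale0r // le0 ge0.
Qed.

(** The simple reflection only changes one coordinate, and a positive root
    other than the simple one has a second positive coordinate. *)
Lemma simple_refl_pos a b : a \in Delta -> b \in pos -> b != a ->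
  refl a *m b \in pos.
Proof.
move=> aD bp ba; have ra := base_root aD; have /mem_pos[rb cb] := bp.
have [//|/mem_pos[_ cN]] := pos_total (root_refl ra rb).
have ltj : (index a Delta < size Delta)%N by rewrite index_mem.
pose j0 := Ordinal ltj; have aE : Delta`_j0 = a by rewrite nth_index.
have b0 j : j != j0 -> cf j b = 0.
  move=> jj0; have /natr_ge0 := coord_nat_comb j cN.
  rewrite reflE linearN linearB linearZ /= -{2}aE.
  rewrite (@coord_free _ _ _ (in_tuple Delta)) ?base_free // eq_sym (negPf jj0).
  rewrite mulr0 subr0 oppr_ge0 => le0; apply/le_anti.
  by rewrite le0 natr_ge0 // coord_nat_comb.
have bE : b = cf j0 b *: a.
  by rewrite {1}(coord_expand b) (bigD1 j0) //= aE big1 ?addr0 // => j /b0 ->; rewrite scale0r.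
have rb' := rb; rewrite bE in rb'.
have [c1|c1] := root_reduced ra rb'; rewrite c1 ?scale1r ?scaleN1r in bE.
  by rewrite bE eqxx in ba.
by have := pos_opp (base_pos aD); rewrite -bE bp.
Qed.

Lemma refl_inj a : a \in Phi -> injective (fun b => refl a *m b).
Proof.
move=> ra x y /(congr1 (mulmx (refl a))).
by rewrite !mulmxA reflK ?root_neq0 // !mul1mx.
Qed.

(** Up to sign, a reflection permutes the positive roots; so twice the half-sum
    changes by twice the positive roots made negative. *)
Lemma rho_refl a : a \in Phi ->
  rho - refl a *m rho =
    - \sum_(b <- pos | refl a *m b \notin pos) (refl a *m b).
Proof.
move=> ra; pose pabs b := if b \in pos then b else - b.
have pm : perm_eq [seq pabs (refl a *m b) | b <- pos] pos.
  have sub : {subset [seq pabs (refl a *m b) | b <- pos] <= pos}.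
    move=> _ /mapP[b bp ->]; rewrite /pabs; case: ifPn => // np.
    by have [|//] := pos_total (root_refl ra (pos_root bp)); rewrite (negPf np).
  have un : uniq [seq pabs (refl a *m b) | b <- pos].
    rewrite map_inj_in_uniq ?pos_uniq // => b c bp cp.
    have oppE : refl a *m b = - (refl a *m c) -> False.
      rewrite -mulmxN => /(refl_inj ra) bE.
      by have := pos_opp cp; rewrite -bE bp.
    rewrite /pabs; case: ifP => _; case: ifP => _.
    - exact: refl_inj.
    - by move/oppE.
    - by move/esym/eqP; rewrite -eqr_oppLR => /eqP/esym/oppE.
    - by move/oppr_inj/(refl_inj ra).
  have [_ memE] := uniq_min_size un sub (eq_leq (esym (size_map _ _))).
  exact: uniq_perm un pos_uniq memE.
have sE : \sum_(b <- pos) b = \sum_(b <- pos) pabs (refl a *m b).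
  by rewrite -[LHS](perm_big _ pm) big_map.
rewrite /half_sum -scalemxAr -scalerBr {1}sE mulmx_sumr -sumrB.
rewrite (bigID (fun b => refl a *m b \in pos)) /= big1 ?add0r; last first.
  by move=> b bp; rewrite /pabs bp subrr.
rewrite scaler_sumr -sumrN; apply: eq_bigr => b /negPf bp.
by rewrite /pabs bp -mulr2n -[(- _) *+ 2]scaler_nat scalerA mulVf ?scale1r ?pnatr_eq0.
Qed.

Lemma rho_refl_int a : a \in Phi -> int_comb Phi (rho - refl a *m rho).
Proof.
move=> ra; rewrite rho_refl //; apply: int_combN; apply: int_comb_sum => b bp _.
by apply: int_comb_mem root_uniq _; apply: root_refl ra (pos_root bp).
Qed.

Lemma rho_simple a : a \in Delta -> pairing rho a = 1.
Proof.
move=> aD; have ra := base_root aD; have a0 := root_neq0 ra.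
have := rho_refl ra; rewrite reflE opprB addrCA subrr addr0.
rewrite big_mkcond (bigD1_seq a (base_pos aD) pos_uniq) /= refl_self //.
rewrite pos_opp ?base_pos //= big1_seq => [|b /andP[ba bp]]; last first.
  by rewrite simple_refl_pos.
rewrite addr0 opprK => /eqP; rewrite -subr_eq0 -{3}[a]scale1r -scalerBl.
by rewrite scaler_eq0 (negPf a0) orbF subr_eq0 => /eqP.
Qed.

Lemma dot_rho_pos a : a \in pos -> 0 < dot rho a.
Proof.
move=> ap; have /mem_pos[ra ca] := ap.
have ge0 j : 0 <= cf j a by exact/natr_ge0/coord_nat_comb.
have dp (j : 'I_(size Delta)) : 0 < dot rho Delta`_j.
  have jD : Delta`_j \in Delta by rewrite mem_nth.
  by rewrite -pairing_gt0 ?rho_simple // root_neq0 // base_root.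
have dE : dot rho a = \sum_j cf j a * dot rho Delta`_j.
  rewrite {1}(coord_expand a) dotC dot_suml; apply: eq_bigr => j _.
  by rewrite dotZl dotC.
have term_ge0 j : true -> 0 <= cf j a * dot rho Delta`_j.
  by move=> _; rewrite mulr_ge0 // ltW.
rewrite lt_neqAle dE sumr_ge0 // andbT eq_sym.
apply/eqP => /psumr_eq0P all0.
have := root_neq0 ra; rewrite (coord_expand a) big1 ?eqxx // => j _.
have /eqP := all0 term_ge0 j isT.
by rewrite mulf_eq0 (gt_eqF (dp j)) orbF => /eqP ->; rewrite scale0r.
Qed.

Lemma pairing_rho_pos a : a \in pos -> 0 < pairing rho a.
Proof. by move=> ap; rewrite pairing_gt0 ?dot_rho_pos // root_neq0 // pos_root. Qed.

Lemma rho2_int : int_comb Phi (2 *: rho).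
Proof.
rewrite /half_sum scalerA mulfV ?scale1r ?pnatr_eq0 //.
apply: int_comb_sum => a ap _; exact: int_comb_mem root_uniq (pos_root ap).
Qed.

Lemma int_comb_pairing q a : int_comb Phi q -> a \in Phi ->
  pairing q a \is a Num.int.
Proof.
move=> [c ->] ra; rewrite pairing_sum big_seq rpred_sum // => b rb.
by rewrite -scaler_int pairingZl rpredM ?intr_int // root_int.
Qed.

Lemma int_comb_refl q a : int_comb Phi q -> a \in Phi -> int_comb Phi (refl a *m q).
Proof.
move=> [c ->] ra; rewrite mulmx_sumr; apply: int_comb_sum => b rb _.
rewrite -scaler_int -scalemxAr scaler_int; apply: int_combMz.
by apply: int_comb_mem root_uniq _; exact: root_refl.
Qed.

(** A nonnegative real multiple of a positive root that lies in the root
    lattice has nonnegative integer coordinates in the base. *)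
Lemma dominance_scale c a x y : a \in pos -> 0 <= c -> y - x = c *: a ->
  int_comb Phi (y - x) -> dominance Phi Delta x y.
Proof.
move=> /mem_pos[ra ca] c0 yx q; apply: nat_comb_coord pos_uniq _ _.
  exact: base_pos.
move=> j; rewrite natrEint coord_int_comb // yx linearZ /=.
by rewrite mulr_ge0 // natr_ge0 // coord_nat_comb.
Qed.

(** * Affine roots and affine reflections *)

Lemma weyl1 : weyl Phi (1%:M : 'M[R]_n).
Proof. by exists [::]; rewrite ?big_nil. Qed.

Lemma weyl_refl_mul a A : a \in Phi -> weyl Phi A -> weyl Phi (refl a *m A).
Proof.
move=> ra [s sP ->]; exists (a :: s); last by rewrite big_cons.
by move=> b; rewrite inE => /orP[/eqP -> //|/sP].
Qed.

Lemma weyl_ind (P : 'M[R]_n -> Prop) : P 1%:M ->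
  (forall a A, a \in Phi -> weyl Phi A -> P A -> P (refl a *m A)) ->
  forall A, weyl Phi A -> P A.
Proof.
move=> P1 PS A [s sP ->]; elim: s sP => [|a s IH] sP; first by rewrite big_nil.
rewrite big_cons; apply: PS; first by apply: sP; rewrite mem_head.
  by exists s => // b bs; apply: sP; rewrite inE bs orbT.
by apply: IH => b bs; apply: sP; rewrite inE bs orbT.
Qed.

Lemma weylM A B : weyl Phi A -> weyl Phi B -> weyl Phi (A *m B).
Proof.
move=> + wB; elim/weyl_ind => [|a C ra _ IH]; first by rewrite mul1mx.
by rewrite -mulmxA; exact: weyl_refl_mul.
Qed.

Lemma weyl_refl a : a \in Phi -> weyl Phi (refl a).
Proof. by move=> ra; rewrite -[refl a]mulmx1; exact: weyl_refl_mul ra weyl1. Qed.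

Lemma weyl_tr A : weyl Phi A -> weyl Phi A^T.
Proof.
elim/weyl_ind => [|a B ra _ IH]; first by rewrite trmx1; exact: weyl1.
by rewrite trmx_mul refl_tr; apply: weylM IH (weyl_refl ra).
Qed.

Lemma weyl_orth A : weyl Phi A -> A^T *m A = 1%:M.
Proof.
elim/weyl_ind => [|a B ra _ IH]; first by rewrite trmx1 mul1mx.
rewrite trmx_mul refl_tr -mulmxA (mulmxA (refl a)) reflK ?mul1mx //.
exact: root_neq0 ra.
Qed.

Lemma weyl_orth_tr A : weyl Phi A -> A *m A^T = 1%:M.
Proof. by move=> /weyl_orth; exact: mulmx1C. Qed.

Lemma weyl_root A a : weyl Phi A -> a \in Phi -> A *m a \in Phi.
Proof.
move=> + ra; elim/weyl_ind => [|b B rb _ IH]; first by rewrite mul1mx.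
by rewrite -mulmxA; exact: root_refl rb IH.
Qed.

Lemma weyl_int A q : weyl Phi A -> int_comb Phi q -> int_comb Phi (A *m q).
Proof.
move=> + qZ; elim/weyl_ind => [|b B rb _ IH]; first by rewrite mul1mx.
by rewrite -mulmxA; exact: int_comb_refl.
Qed.

Lemma weyl_invmx A : weyl Phi A -> invmx A = A^T.
Proof.
move=> wA; have AA := weyl_orth_tr wA; have [uA _] := mulmx1_unit AA.
by rewrite -[invmx A]mulmx1 -AA mulKmx.
Qed.

Lemma W1 : W aone.
Proof.
split; first exact: weyl1.
by exists 0; [exact: int_comb0|rewrite scaler0].
Qed.

Lemma WM g h : W g -> W h -> W (amul g h).
Proof.
move=> [wg [q qZ gE]] [wh [r rZ hE]]; split; first exact: weylM.
exists (g.1 *m r + q); first by apply: int_combD => //; exact: weyl_int.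
by rewrite /= gE hE -scalemxAr scalerDr.
Qed.

Lemma WV g : W g -> W (ainv g).
Proof.
move=> [wg [q qZ gE]]; rewrite /ainv weyl_invmx //.
split; first exact: weyl_tr.
exists (- (g.1^T *m q)); first exact/int_combN/weyl_int/qZ/weyl_tr.
by rewrite /= gE -scalemxAr scalerN.
Qed.

Lemma actVK g x : W g -> act (ainv g) (act g x) = x.
Proof.
move=> [wg _]; rewrite /act /ainv weyl_invmx //= mulmxDr mulmxA.
by rewrite weyl_orth // mul1mx addrK.
Qed.

Lemma actKV g x : W g -> act g (act (ainv g) x) = x.
Proof.
move=> [wg _]; rewrite /act /ainv weyl_invmx //= mulmxBr !mulmxA.
by rewrite weyl_orth_tr // !mul1mx subrK.
Qed.

Lemma amulVg g : W g -> amul (ainv g) g = aone.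
Proof. by move=> wg; apply: affine_ext => x; rewrite act_mul act1 actVK. Qed.

Lemma amulgV g : W g -> amul g (ainv g) = aone.
Proof. by move=> wg; apply: affine_ext => x; rewrite act_mul act1 actKV. Qed.

Lemma ainv_unique g h : W g -> amul g h = aone -> ainv g = h.
Proof. by move=> Wg gh; rewrite -[LHS]amulg1 -gh amulA amulVg // amul1g. Qed.

Lemma ainvM g h : W g -> W h -> ainv (amul g h) = amul (ainv h) (ainv g).
Proof.
move=> Wg Wh; apply: ainv_unique; first exact: WM.
by rewrite amulA -(amulA g) amulgV // amulg1 amulgV.
Qed.

Lemma ainvK g : W g -> ainv (ainv g) = g.
Proof. by move=> Wg; apply: ainv_unique; [exact: WV|exact: amulVg]. Qed.

(** The affine root [(a, k)], as an affine functional: it vanishes on the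
    hyperplane of the reflection [affine_refl e a k]. *)
Definition aval al x : R := pairing x al.1 - al.2%:~R * e%:R.

Definition aneg al : aroot := (- al.1, - al.2).

Definition arefl al : affine := affine_refl e al.1 al.2.

(** The affine root [al \o act g]; the floor recovers the integer by which the
    translation part of [g] shifts [al]. *)
Definition pullback g al : aroot :=
  (g.1^T *m al.1, al.2 - Num.floor (pairing g.2 al.1 / e%:R)).

Lemma aval_pullback g al x : W g -> al.1 \in Phi ->
  aval (pullback g al) x = aval al (act g x).
Proof.
move=> [wg [q qZ gE]] ra; rewrite /aval /act /= pairingDl.
have -> : pairing (g.1 *m x) al.1 = pairing x (g.1^T *m al.1).
  rewrite -(pairing_orth x (g.1^T *m al.1) (weyl_orth wg)).
  by rewrite mulmxA weyl_orth_tr // mul1mx.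
have /intrP[j jE] := int_comb_pairing qZ ra.
rewrite gE pairingZl jE mulrAC mulfV // mul1r intrKfloor intrB mulrBl.
by ring.
Qed.

Lemma pullback_root g al : W g -> al.1 \in Phi -> (pullback g al).1 \in Phi.
Proof. by move=> [wg _]; exact: weyl_root (weyl_tr wg). Qed.

Lemma aval_neg al x : aval (aneg al) x = - aval al x.
Proof. by rewrite /aval /= pairingNr intrN mulNr -opprD. Qed.

Lemma aneg_root al : al.1 \in Phi -> (aneg al).1 \in Phi.
Proof. exact: root_opp. Qed.

Lemma anegK al : aneg (aneg al) = al.
Proof. by case: al => a k; rewrite /aneg /= !opprK. Qed.

Lemma act_arefl al x : act (arefl al) x = x - aval al x *: al.1.
Proof. by rewrite /act /= reflE /aval scalerBl opprB addrA addrAC. Qed.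

Lemma arefl_neg al : arefl (aneg al) = arefl al.
Proof. by apply: affine_ext => x; rewrite !act_arefl aval_neg scalerN scaleNr opprK. Qed.

Lemma aval_arefl al x : al.1 \in Phi -> aval al (act (arefl al) x) = - aval al x.
Proof.
move=> /root_neq0 a0; rewrite act_arefl /aval pairingBl pairingZl pairing_self //.
by ring.
Qed.

Lemma arefl_fix al x : aval al x = 0 -> act (arefl al) x = x.
Proof. by rewrite act_arefl => ->; rewrite scale0r subr0. Qed.

Lemma areflK al : al.1 \in Phi -> amul (arefl al) (arefl al) = aone.
Proof.
move=> ra; apply: affine_ext => x; rewrite act_mul act1.
by rewrite act_arefl aval_arefl // scaleNr opprK act_arefl subrK.
Qed.

Lemma W_arefl al : al.1 \in Phi -> W (arefl al).
Proof.
move=> ra; split; first exact: weyl_refl.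
exists (al.1 *~ al.2); first exact/int_combMz/int_comb_mem/ra/root_uniq.
by rewrite /= -[al.1 *~ _]scaler_int scalerA mulrC.
Qed.

Lemma ainv_arefl al : al.1 \in Phi -> ainv (arefl al) = arefl al.
Proof. by move=> ra; apply: ainv_unique (areflK ra); exact: W_arefl. Qed.

Lemma arefl_conj g al : W g -> al.1 \in Phi ->
  amul g (arefl (pullback g al)) = amul (arefl al) g.
Proof.
move=> Wg ra; apply: affine_ext => x; rewrite !act_mul !act_arefl.
rewrite aval_pullback // /act mulmxBr -scalemxAr mulmxA (weyl_orth_tr (proj1 Wg)) mul1mx.
by rewrite addrAC.
Qed.

(** The inversion [a |-> coroot a] preserves rays, and a reduced root system
    meets each ray at most once. *)
Lemma coroot_inj_pos a b r : a \in Phi -> b \in Phi -> 0 < r ->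
  coroot b = r *: coroot a -> b = a.
Proof.
move=> ra rb r0; rewrite /coroot scalerA.
have da : 0 < dot a a by rewrite dot_gt0 root_neq0.
have db : 0 < dot b b by rewrite dot_gt0 root_neq0.
move/(congr1 (fun z => (dot b b / 2) *: z)); rewrite !scalerA.
rewrite mulrA divfK ?pnatr_eq0 // divff ?gt_eqF // scale1r.
have : 0 < dot b b / 2 * (r * (2 / dot a a)).
  by rewrite !mulr_gt0 ?invr_gt0 ?ltr0n.
move: (_ * (_ * _)) => c c0 bE; rewrite bE in rb *.
have [c1|c1] := root_reduced ra rb; first by rewrite c1 scale1r.
by rewrite c1 ltr0N1 in c0.
Qed.

Lemma aval_inj al be : al.1 \in Phi -> be.1 \in Phi ->
  (forall x, aval al x = aval be x) -> al = be.
Proof.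
case: al be => [a k] [b m] /= ra rb E.
have km : k = m.
  have := E 0; rewrite /aval /= /pairing !dot0l !sub0r => /oppr_inj/(mulIf e0).
  exact: intr_inj.
congr pair => //; apply: (@coroot_inj_pos _ _ 1) => //; rewrite scale1r.
have {}E x : dot x (coroot a) = dot x (coroot b).
  by have := E x; rewrite /aval /= km => /addIr.
by apply/eqP; rewrite -subr_eq0 -dot_eq0 dotDr dotNr E subrr.
Qed.

Lemma pullback_inj g al be : W g -> al.1 \in Phi -> be.1 \in Phi ->
  pullback g al = pullback g be -> al = be.
Proof.
move=> Wg ra rb E; apply: aval_inj => // x.
by rewrite -(actKV x Wg) -(aval_pullback _ Wg ra) -(aval_pullback _ Wg rb) E.
Qed.

Lemma hyperplane_aval al x :
  hyperplane Phi Delta e al.1 al.2 x <-> aval al (x + rho) = 0.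
Proof.
rewrite /hyperplane /aval /=; split=> [->|/eqP]; first by rewrite subrr.
by rewrite subr_eq0 => /eqP.
Qed.

(** By [same_kernel] the two roots are proportional, hence equal up to sign as the
    system is reduced; a common point then determines the constant. *)
Lemma hyperplane_inj al be : al.1 \in Phi -> be.1 \in Phi ->
  hyperplane Phi Delta e be.1 be.2 = hyperplane Phi Delta e al.1 al.2 ->
  be = al \/ be = aneg al.
Proof.
move=> ra rb E.
have a0 := root_neq0 ra; have b0 := root_neq0 rb.
have {}E x : aval al x = 0 -> aval be x = 0.
  rewrite -{1 2}(subrK rho x) => /hyperplane_aval; rewrite -E.
  by move/hyperplane_aval.
(* the foot of the perpendicular from the origin to the hyperplane of [al] *)
pose p := (al.2%:~R * e%:R / 2) *: al.1.
have p0 : aval al p = 0 by rewrite /aval pairingZl pairing_self // divfK ?subrr ?pnatr_eq0.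
have q0 := E _ p0.
have ker d : dot d al.1 = 0 -> dot d be.1 = 0.
  move=> d0; have : aval be (p + d) = 0.
    by apply: E; rewrite /aval pairingDl [pairing d _]pairingE d0 mulr0 addr0.
  rewrite /aval pairingDl addrAC -/(aval be p) q0 add0r => /eqP.
  rewrite pairingE mulf_eq0 mulf_eq0 pnatr_eq0 invr_eq0 dot_eq0 (negPf b0) /=.
  by move/eqP.
have bE := same_kernel a0 ker.
have key ga : ga.1 \in Phi -> be.1 = ga.1 -> aval ga p = 0 -> be = ga.
  move=> rg E1 gp; apply: aval_inj => // x; move/eqP: q0; move/eqP: gp.
  by rewrite /aval E1 !subr_eq0 => /eqP <- /eqP <-.
have rb' := rb; rewrite bE in rb'.
have [c1|c1] := root_reduced ra rb'; rewrite c1 ?scale1r ?scaleN1r in bE.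
  by left; exact: key.
by right; apply: key; rewrite ?aneg_root // aval_neg p0 oppr0.
Qed.

Lemma dot_act_shift g x : dot_act Phi Delta g x + rho = act g (x + rho).
Proof. by rewrite /dot_act /act addrAC subrK. Qed.

(** * Alcove and walls *)

Definition in_alcove x := forall a, a \in pos -> 0 < pairing x a < e%:R.
Definition in_closed_alcove x := forall a, a \in pos -> 0 <= pairing x a <= e%:R.

(** A small positive multiple of [rho] lies in the alcove. *)
Lemma alcove_nonempty : exists x, in_alcove x.
Proof.
pose S := \sum_(a <- pos) pairing rho a.
have S0 : 0 <= S by rewrite /S big_seq sumr_ge0 // => a /pairing_rho_pos/ltW.
have S1 : 0 < 1 + S by rewrite ltr_pwDl.
exists ((1 + S)^-1 *: rho) => a ap; rewrite pairingZl.
have r0 := pairing_rho_pos ap.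
rewrite mulr_gt0 ?invr_gt0 //= mulrC ltr_pdivrMr //.
have rS : pairing rho a <= S.
  rewrite /S (bigD1_seq a ap pos_uniq) /= lerDl big_seq_cond sumr_ge0 //.
  by move=> b /andP[/pairing_rho_pos/ltW].
have e1 : 1 <= e%:R :> R by rewrite ler1n.
by apply: (@lt_le_trans _ _ (1 + S)); [lra|rewrite ler_peMl // ltW].
Qed.

Lemma aval_line al x (v : 'cV[R]_n) t : aval al (x + t *: v) = aval al x + t * pairing v al.1.
Proof. by rewrite /aval pairingDl pairingZl addrAC. Qed.

Lemma aval_segment al x y t :
  aval al (x + t *: (y - x)) = aval al x + t * (aval al y - aval al x).
Proof. by rewrite aval_line pairingBl /aval; congr (_ + _ * _); ring. Qed.

(** The alcove is bounded by the hyperplanes [(a, 0)] and [(a, 1)] on which a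
    positive root takes two consecutive multiples of [e], so no hyperplane meets
    it. *)
Lemma alcove_sign al : al.1 \in Phi ->
  [/\ forall x, in_alcove x -> 0 < aval al x
    & forall x, in_closed_alcove x -> 0 <= aval al x] \/
  [/\ forall x, in_alcove x -> aval al x < 0
    & forall x, in_closed_alcove x -> aval al x <= 0].
Proof.
have main be : be.1 \in pos -> [/\ forall x, in_alcove x -> 0 < aval be x
    & forall x, in_closed_alcove x -> 0 <= aval be x] \/
  [/\ forall x, in_alcove x -> aval be x < 0
    & forall x, in_closed_alcove x -> aval be x <= 0].
  case: be => b m /= bp; rewrite /aval /=.
  have [m0|m1] := leP m 0; [left|right].
    have : m%:~R * e%:R <= 0 :> R by rewrite mulr_le0_ge0 ?lerz0 // ltW.
    by move=> ?; split=> x /(_ _ bp) /andP[? ?]; lra.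
  have : e%:R <= m%:~R * e%:R :> R by rewrite ler_peMl ?ler1z // ltW.
  by move=> ?; split=> x /(_ _ bp) /andP[? ?]; lra.
move=> ra; have [/main //|/(main (aneg al))] := pos_total ra.
case=> -[H1 H2]; [right|left]; split=> x Cx.
- by have := H1 x Cx; rewrite aval_neg oppr_gt0.
- by have := H2 x Cx; rewrite aval_neg oppr_ge0.
- by have := H1 x Cx; rewrite aval_neg oppr_lt0.
- by have := H2 x Cx; rewrite aval_neg oppr_le0.
Qed.

Lemma aval_alcove_neq0 al x : al.1 \in Phi -> in_alcove x -> aval al x != 0.
Proof. by move=> /alcove_sign[][H _] /H; [exact: lt0r_neq0|exact: ltr0_neq0]. Qed.

Lemma alcove_same_side al x y : al.1 \in Phi -> in_alcove x -> in_alcove y ->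
  (0 < aval al x) = (0 < aval al y).
Proof.
move=> /alcove_sign[][H _] Cx Cy; first by rewrite !H.
by rewrite !ltNge !(ltW (H _ _)).
Qed.

(** The affine roots [(a, 0)] and [(- a, -1)], with [a] positive, are positive on
    the alcove, and they express its inequalities. *)
Lemma closed_alcove_intro x : (forall al, al.1 \in Phi ->
    (forall z, in_alcove z -> 0 < aval al z) -> 0 <= aval al x) ->
  in_closed_alcove x.
Proof.
move=> H a ap; have ra := pos_root ap.
have := H (a, 0) ra; have := H (- a, -1) (root_opp ra).
rewrite /aval /= pairingNr mul0r mulN1r opprK subr0 addrC subr_ge0 => -> //.
  by rewrite andbT; apply=> z /(_ _ ap) /andP[]; rewrite subr0.
by move=> z /(_ _ ap) /andP[_]; rewrite pairingNr addrC subr_gt0.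
Qed.

Lemma alcove_intro x : in_closed_alcove x ->
  (forall al, al.1 \in Phi -> aval al x != 0) -> in_alcove x.
Proof.
move=> Cx H a ap; have ra := pos_root ap; have /andP[ge0 le1] := Cx a ap.
have := H (a, 0) ra; have := H (- a, -1) (root_opp ra).
rewrite /aval /= pairingNr mul0r subr0 mulN1r opprK addrC subr_eq0.
by move=> n1 n0; rewrite !lt_neqAle ge0 le1 eq_sym n0 eq_sym n1.
Qed.

Lemma pairing_continuous a : continuous (fun x : 'cV[R]_n => pairing x a).
Proof.
suff H (s : seq 'I_n) :
  continuous (fun x : 'cV[R]_n => \sum_(i <- s) x i 0 * coroot a i 0) by exact: H.
elim: s => [|i s IH].
  by under eq_fun do rewrite big_nil; exact: cst_continuous.
under eq_fun do rewrite big_cons.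
move=> x; apply: (@continuousD R R^o _ (fun z : 'cV[R]_n => z i 0 * coroot a i 0) _ x _ (IH x)).
apply: (@continuousM R _ (fun z : 'cV[R]_n => z i 0) (fun=> coroot a i 0)).
  exact: coord_continuous.
exact: cst_continuous.
Qed.

Lemma closure_alcoveP x :
  closure (alcove Phi Delta e) x <-> in_closed_alcove (x + rho).
Proof.
split=> [clx a ap|Cx].
  have cnt := @pairing_continuous a x.
  rewrite pairingDl; apply/andP; split; rewrite leNgt; apply/negP => lt.
    have {}lt : pairing x a < - pairing rho a by lra.
    have [z [/(_ _ ap) /andP[+ _] /=]] := clx _ (cvgr_lt _ cnt _ lt).
    by rewrite pairingDl; lra.
  have {}lt : e%:R - pairing rho a < pairing x a by lra.
  have [z [/(_ _ ap) /andP[_ +] /=]] := clx _ (cvgr_gt _ cnt _ lt).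
  by rewrite pairingDl; lra.
(* conversely, all points other than [x + rho] of the segment from it to a point
   of the alcove lie in the alcove *)
have [c Cc] := alcove_nonempty => B Bx.
pose path (t : R) : 'cV[R]_n := x + t *: (c - (x + rho)).
have cnt : {for 0, continuous path}.
  apply: continuousD; first exact: cst_continuous.
  by apply: continuousZr_tmp; exact: cvg_id.
have /nbhs_ballP[eps /= eps0 epsB] : nbhs 0 (path @^-1` B)%classic.
  by apply: cnt; rewrite /path scale0r addr0.
pose t := Num.min (eps / 2) (1 / 2).
have t0 : 0 < t by rewrite lt_min !divr_gt0.
have t1 : t < 1 by rewrite gt_min; apply/orP; right; lra.
have te : t < eps by rewrite gt_min; apply/orP; left; lra.
exists (path t); split; last first.
  by apply: epsB; rewrite -ball_normE /= sub0r normrN gtr0_norm.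
move=> a ap; rewrite /path addrAC pairingDl pairingZl pairingBl.
have /andP[c0 c1] := Cc a ap; have /andP[x0 x1] := Cx a ap.
by apply/andP; split; nra.
Qed.

(** The affine roots of the hyperplanes that support a face of codimension one,
    with both signs. *)
Definition wall al := al.1 \in Phi /\ exists x,
  [/\ in_closed_alcove x, aval al x = 0 &
      forall be, be.1 \in Phi -> aval be x = 0 -> be = al \/ be = aneg al].

Lemma fundamentalP s :
  fundamental s <-> exists2 al, wall al & s = arefl al.
Proof.
split=> [[a [k [ra [x [clx hx] only] ->]]]|[al [ra [x [Cx x0 only]]] ->]].
  exists (a, k) => //; split=> //; exists (x + rho).
  split; first by apply/closure_alcoveP.
    by apply/hyperplane_aval.
  move=> [b m] /= rb b0; apply: hyperplane_inj => //.
  by apply: only => //; apply/(@hyperplane_aval (b, m)).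
exists al.1, al.2; split=> //; exists (x - rho).
  split; first by apply/closure_alcoveP; rewrite subrK.
  by apply/hyperplane_aval; rewrite subrK.
move=> b m rb /(@hyperplane_aval (b, m)); rewrite subrK => b0.
have [E|E] := only (b, m) rb b0; apply/seteqP; split=> z.
- by move=> /(@hyperplane_aval (b, m)); rewrite E => /hyperplane_aval.
- by move=> /hyperplane_aval; rewrite -E => /(@hyperplane_aval (b, m)).
- move=> /(@hyperplane_aval (b, m)); rewrite E aval_neg => /eqP.
  by rewrite oppr_eq0 => /eqP/hyperplane_aval.
- move=> /hyperplane_aval z0; apply/(@hyperplane_aval (b, m)).
  by rewrite E aval_neg z0 oppr0.
Qed.

Lemma closed_alcove_same_side al x y : al.1 \in Phi -> in_alcove x ->
  in_closed_alcove y -> aval al y != 0 -> (0 < aval al x) = (0 < aval al y).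
Proof.
move=> ra Cx Cy y0; have [[H1 H2]|[H1 H2]] := alcove_sign ra.
  by rewrite H1 // lt_neqAle eq_sym y0 H2.
by rewrite !ltNge (ltW (H1 _ Cx)) H2.
Qed.

(** A point of the closed alcove lying on one hyperplane only is fixed by the
    reflection in it, so every other affine root has on the alcove and on its
    mirror image the sign that it has at this point. *)
Lemma wall_separation al be c : al.1 \in Phi -> wall be -> in_alcove c ->
  (0 < aval al c) != (0 < aval al (act (arefl be) c)) -> al = be \/ al = aneg be.
Proof.
move=> ra [rb [x [Cx x0 only]]] Cc neq; apply: only => //; apply/eqP.
apply: contraNT neq => alx0; have Ws : W (arefl be) := W_arefl rb.
rewrite -(aval_pullback c Ws ra).
have rp := pullback_root Ws ra.
have xE : aval (pullback (arefl be) al) x = aval al x.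
  by rewrite (aval_pullback x Ws ra) arefl_fix.
rewrite (closed_alcove_same_side ra Cc Cx alx0).
by rewrite (closed_alcove_same_side rp Cc Cx) xE.
Qed.

(** The alcove is open, so finitely many hyperplanes do not cover it. This is
    used to move the base point off the loci where a segment from it would meet
    the intersection of two reflecting hyperplanes. *)
Lemma generic_point (l : seq ('cV[R]_n * R)) : (forall vr, vr \in l -> vr.1 != 0) ->
  exists2 x, in_alcove x & forall vr, vr \in l -> dot x vr.1 != vr.2.
Proof.
elim: l => [|[v r] l IH] l0; first by have [x Cx] := alcove_nonempty; exists x.
have [|x Cx xl] := IH; first by move=> w wl; apply: l0; rewrite inE wl orbT.
have [xv|xv] := eqVneq (dot x v) r; last first.
  by exists x => // w; rewrite inE => /orP[/eqP ->|/xl].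
have v0 : v != 0 by exact: (l0 _ (mem_head _ _)).
(* moving [x] slightly along [v] leaves the new hyperplane and keeps every
   strict inequality that already holds *)
pose sg (w : 'cV[R]_n * R) := Num.sg (dot x w.1 - w.2).
pose s1 := [seq (pairing x a, pairing v a) | a <- pos].
pose s2 := [seq (e%:R - pairing x a, - pairing v a) | a <- pos].
pose s3 := [seq (sg vr * (dot x vr.1 - vr.2), sg vr * dot v vr.1) | vr <- l].
have [|eps eps0 epsP] := @small_perturbation R (s1 ++ s2 ++ s3).
  move=> pq; rewrite !mem_cat => /or3P[] /mapP[z zP -> /=].
  - by have /andP[] := Cx _ zP.
  - by have /andP[_] := Cx _ zP; rewrite subr_gt0.
  - by rewrite /sg -normrEsg normr_gt0 subr_eq0 xl.
exists (x + eps *: v).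
  move=> a ap; rewrite pairingDl pairingZl; apply/andP; split.
    by apply: (epsP (pairing x a, pairing v a)); rewrite !mem_cat map_f.
  have := epsP (e%:R - pairing x a, - pairing v a).
  rewrite !mem_cat (map_f (fun a => (e%:R - pairing x a, - pairing v a)) ap) orbT /=.
  by move=> /(_ isT); lra.
move=> w; rewrite inE => /orP[/eqP -> /=|wl].
  rewrite dotDl dotZl xv -subr_eq0 addrAC subrr add0r mulf_eq0 (gt_eqF eps0).
  by rewrite dot_eq0.
have := epsP (sg w * (dot x w.1 - w.2), sg w * dot v w.1).
rewrite !mem_cat (map_f (fun vr => (sg vr * (dot x vr.1 - vr.2), sg vr * dot v vr.1)) wl) !orbT /=.
move=> /(_ isT) gt0; apply/eqP => E; move: gt0.
have -> : sg w * (dot x w.1 - w.2) + eps * (sg w * dot v w.1) =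
  sg w * (dot (x + eps *: v) w.1 - w.2) by rewrite dotDl dotZl; ring.
by rewrite E subrr mulr0 ltxx.
Qed.

Lemma coroot_neq0 a : a \in Phi -> coroot a != 0.
Proof.
move=> /root_neq0 a0; rewrite scaler_eq0 negb_or a0 andbT.
by rewrite mulf_neq0 ?pnatr_eq0 // invr_eq0 dot_eq0.
Qed.

(** The crossing times of the segment from a point [x] to [y] with the
    hyperplanes of [al] and [be] coincide when an affine function of [x] vanishes,
    whose gradient is the combination of coroots below. It is zero only if the two
    affine roots are equal. *)
Lemma separating_proportional al be y : al.1 \in Phi -> be.1 \in Phi ->
  aval al y < 0 -> aval be y < 0 ->
  aval be y *: coroot al.1 - aval al y *: coroot be.1 = 0 -> al = be.
Proof.
move=> ra rb ay bY /eqP; rewrite subr_eq0 => /eqP E.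
have ab : be.1 = al.1.
  apply: (@coroot_inj_pos _ _ (aval be y / aval al y)) => //.
    by rewrite nmulr_rgt0 // invr_lt0.
  by rewrite mulrC -scalerA E scalerA mulVf ?scale1r // lt_eqF.
have vE : aval be y = aval al y.
  move/eqP: E; rewrite ab -subr_eq0 -scalerBl scaler_eq0 (negPf (coroot_neq0 ra)).
  by rewrite orbF subr_eq0 => /eqP.
apply: aval_inj => // x; move: vE.
rewrite /aval ab => /addrI/oppr_inj -> //.
Qed.

Context {c : 'cV[R]_n} (Cc : in_alcove c).

Lemma int_shift (k : int) (M : nat) : k <= M%:Z -> - M%:Z <= k ->
  exists2 j, (j < (M + M).+1)%N & k = j%:Z - M%:Z.
Proof. by move=> kM Mk; exists (absz (k + M%:Z)); lia. Qed.

(** If [(a, k)] separates [c] from [y], then [k * e] lies between the values of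
    [a] at the two points, which bounds [k]. *)
Lemma separating_finite y : exists L : seq aroot, forall al, al.1 \in Phi ->
  0 < aval al c -> aval al y < 0 -> al \in L.
Proof.
pose B : R := \sum_(a <- Phi) (`|pairing c a| + `|pairing y a|).
pose M := (Num.truncn B).+1.
have BM : B < M%:R by exact: truncnS_gt.
pose f (a : 'cV[R]_n) (k : nat) : aroot := (a, k%:Z - M%:Z).
exists [seq f a k | a <- Phi, k <- iota 0 (M + M).+1] => -[a k].
rewrite [(a, k).1]/= /aval [(a, k).1]/= [(a, k).2]/= => ra ck yk.
have le1 : `|pairing c a| + `|pairing y a| <= B.
  rewrite /B (bigD1_seq a ra root_uniq) /= lerDl.
  by apply: sumr_ge0 => b _; exact: addr_ge0.
have := ler_norm (pairing c a); have := ler_norm (- pairing y a); rewrite normrN.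
have := normr_ge0 (pairing c a); have := normr_ge0 (pairing y a) => h1 h2 h3 h4.
have e1 : 1 <= e%:R :> R by rewrite ler1n.
have kle : k <= M%:Z.
  rewrite -(ler_int R) leNgt; apply/negP => Mk.
  have : M%:R * e%:R <= k%:~R * e%:R :> R by rewrite ler_wpM2r // ltW.
  have : M%:R <= M%:R * e%:R :> R by rewrite ler_peMr.
  by lra.
have kge : - M%:Z <= k.
  rewrite -(ler_int R) leNgt; apply/negP => Mk.
  have : k%:~R * e%:R <= (- M%:Z)%:~R * e%:R :> R by rewrite ler_wpM2r // ltW.
  have : M%:R <= M%:R * e%:R :> R by rewrite ler_peMr.
  by rewrite intrN; lra.
have [j jM ->] := int_shift kle kge.
by apply: (allpairs_f f ra); rewrite mem_iota.
Qed.

(** On a segment from a generic point of the alcove to [y], the separating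
    hyperplanes are crossed one at a time; the first one crossed is a wall. *)
Lemma wall_exists y : ~ in_closed_alcove y ->
  exists be, [/\ wall be, 0 < aval be c & aval be y < 0].
Proof.
move=> nCy; have [L0 L0P] := separating_finite y.
pose L := [seq al <- L0 | [&& al.1 \in Phi, 0 < aval al c & aval al y < 0]].
have LP al : reflect [/\ al.1 \in Phi, 0 < aval al c & aval al y < 0] (al \in L).
  apply: (iffP idP) => [|[H1 H2 H3]]; first by rewrite mem_filter => /andP[/and3P[]].
  by rewrite mem_filter H1 H2 H3 L0P.
have posC al x : al.1 \in Phi -> in_alcove x -> (0 < aval al x) = (0 < aval al c).
  by move=> ra Cx; apply: alcove_same_side.
have Lnil : L != [::].
  apply/eqP => L0E; apply: nCy; apply: closed_alcove_intro => al ra Cal.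
  rewrite leNgt; apply/negP => aly.
  have : al \in L by apply/LP; split=> //; exact: Cal.
  by rewrite L0E.
pose prs := [seq p <- [seq (al, be) | al <- L, be <- L] | p.1 != p.2].
(* gradient and constant of the affine function of [x] that vanishes when the
   segment from [x] to [y] crosses both hyperplanes at once *)
pose fn (p : aroot * aroot) :=
  (aval p.2 y *: coroot p.1.1 - aval p.1 y *: coroot p.2.1,
   aval p.2 y * (p.1.2%:~R * e%:R) - aval p.1 y * (p.2.2%:~R * e%:R)).
have prsP al be : al \in L -> be \in L -> al != be -> (al, be) \in prs.
  by move=> aL bL ne; rewrite mem_filter ne; apply: allpairs_f.
have [|x Cx xgen] := @generic_point (map fn prs).
  move=> vr /mapP[[al be]]; rewrite mem_filter => /andP[ne].
  move=> /allpairsPdep[al' [be' [aL bL [E1 E2]]]] -> /=; subst al' be'.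
  have /LP[ra _ aY] := aL; have /LP[rb _ bY] := bL.
  by apply: contraNneq ne => /(separating_proportional ra rb aY bY) ->.
have {}xgen al be : al \in L -> be \in L -> al != be ->
    aval be y * aval al x != aval al y * aval be x.
  move=> aL bL ne; have := xgen (fn (al, be)) (map_f fn (prsP _ _ aL bL ne)).
  apply: contraNneq => E; rewrite /fn /= dotDr dotNr.
  rewrite (dotZr _ _ (coroot al.1)) (dotZr _ _ (coroot be.1)).
  have pE ga : dot x (coroot ga.1) = aval ga x + ga.2%:~R * e%:R.
    by rewrite /aval subrK.
  by rewrite !pE; apply/eqP; lra.
(* the time at which the segment crosses the hyperplane of [al] *)
pose t al := aval al x / (aval al x - aval al y).
have tE al : al \in L -> [/\ 0 < aval al x, aval al y < 0 & t al * (aval al x - aval al y) = aval al x].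
  move=> /LP[ra ac ay]; have ax : 0 < aval al x by rewrite posC.
  by split=> //; rewrite divfK // gt_eqF //; lra.
have [be bL tmin] := seq_argmin t Lnil.
have [bx bY tb] := tE be bL; have /LP[rb bc _] := bL.
have t0 : 0 < t be by rewrite divr_gt0 //; lra.
have t1 : t be < 1 by nra.
pose p := x + t be *: (y - x).
have pE al : aval al p = aval al x + t be * (aval al y - aval al x) by exact: aval_segment.
have pge al : al.1 \in Phi -> 0 < aval al c -> 0 <= aval al p /\ (aval al p = 0 -> al = be).
  move=> ra ac; have ax : 0 < aval al x by rewrite posC.
  rewrite pE; have [ay|ay] := leP 0 (aval al y).
    by split=> [|p0]; [nra|exfalso; nra].
  have aL : al \in L by apply/LP.
  have [_ _ ta] := tE al aL; have tab := tmin al aL.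
  have key : t be * (aval al x - aval al y) <= t al * (aval al x - aval al y).
    by rewrite ler_pM2r // subr_gt0 (lt_trans ay ax).
  split=> [|p0]; first by lra.
  apply/eqP; rewrite -[_ == _]negbK; apply/negP => ne.
  have /negP := xgen _ _ aL bL ne; apply.
  have E1 : aval al x = t be * (aval al x - aval al y) by lra.
  have E2 : aval be x = t be * (aval be x - aval be y) by lra.
  apply/eqP; apply: (mulfI (lt0r_neq0 (_ : 0 < 1 - t be))); first by lra.
  by nra.
exists be; split=> //; split=> //; exists p; split.
- apply: closed_alcove_intro => al ra Cal.
  by have [] := pge al ra (Cal c Cc).
- by rewrite pE; lra.
- move=> al ra p0; have := aval_alcove_neq0 ra Cc.
  rewrite neq_lt => /orP[ac|ac]; last by left; apply: (pge al ra ac).2.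
  right; rewrite -[LHS]anegK.
  congr aneg; apply: (pge (aneg al) (aneg_root ra) _).2; rewrite aval_neg.
    by rewrite oppr_gt0.
  by rewrite p0 oppr0.
Qed.

(** * Generation by the reflections in the walls *)

(** The base point [c] stands for the alcove: no hyperplane meets the alcove, so
    this does not depend on its choice. *)
Definition side al g : bool := 0 < aval al (act g c).

Lemma side_neq0 al g : W g -> al.1 \in Phi -> aval al (act g c) != 0.
Proof.
move=> Wg ra; rewrite -(aval_pullback c Wg ra).
exact: aval_alcove_neq0 (pullback_root Wg ra) Cc.
Qed.

Lemma side_neg al g : W g -> al.1 \in Phi -> side (aneg al) g = ~~ side al g.
Proof.
move=> Wg ra; rewrite /side aval_neg oppr_gt0 -leNgt le_eqVlt.
by rewrite (negPf (side_neq0 Wg ra)).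
Qed.

Lemma side_pullback al g h : W g -> al.1 \in Phi ->
  side (pullback g al) h = side al (amul g h).
Proof. by move=> Wg ra; rewrite /side act_mul aval_pullback. Qed.

Lemma side_arefl al g : W g -> al.1 \in Phi ->
  side al (amul (arefl al) g) = ~~ side al g.
Proof.
move=> Wg ra; rewrite -side_neg // /side act_mul aval_arefl //.
by rewrite aval_neg.
Qed.

(** Only the common wall separates the adjacent alcoves of [g] and of
    [amul g (arefl be)]: this is [wall_separation] moved by [g]. *)
Lemma side_cross al be g : W g -> al.1 \in Phi -> wall be ->
  side al g != side al (amul g (arefl be)) ->
  amul g (arefl be) = amul (arefl al) g.
Proof.
move=> Wg ra wb; have rp := pullback_root Wg ra.
rewrite -{1}[g]amulg1 -!side_pullback // /side act1.
move=> /(wall_separation rp wb Cc) E.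
rewrite -(arefl_conj Wg ra); congr amul.
by case: E => ->; rewrite ?arefl_neg.
Qed.

Lemma wall_root be : wall be -> be.1 \in Phi. Proof. by case. Qed.

Lemma fundamental_W s : fundamental s -> W s.
Proof. by move=> /fundamentalP[be /wall_root rb ->]; exact: W_arefl. Qed.

Lemma expression_W g l : expression g l -> W g.
Proof.
move=> [lP ->]; elim: l lP => [|s l IH] lP; first exact: W1.
apply: WM => //; first by apply: fundamental_W; apply: lP; rewrite mem_head.
by apply: IH => t tl; apply: lP; rewrite inE tl orbT.
Qed.

Lemma expression_nil : expression aone [::].
Proof. by []. Qed.

Lemma expression_cons s g l : fundamental s -> expression g l ->
  expression (amul s g) (s :: l).
Proof.
by move=> fs [lP ->]; split=> // t; rewrite inE => /orP[/eqP ->|/lP].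
Qed.

Lemma expression1 s : fundamental s -> expression s [:: s].
Proof.
by move=> fs; rewrite -{1}[s]amulg1; apply: expression_cons fs expression_nil.
Qed.

Lemma expression_consP s g l : expression g (s :: l) ->
  fundamental s /\ exists2 h, expression h l & g = amul s h.
Proof.
move=> [lP ->]; split; first by apply: lP; rewrite mem_head.
exists (foldr (@amul R n) aone l) => //; split=> // t tl.
by apply: lP; rewrite inE tl orbT.
Qed.

Lemma expression_cat g h l1 l2 : expression g l1 -> expression h l2 ->
  expression (amul g h) (l1 ++ l2).
Proof.
move=> + eh; elim: l1 g => [|s l1 IH] g.
  by move=> [_ ->]; rewrite amul1g.
move=> /expression_consP[fs [k ek ->]]; rewrite -amulA.
by apply: expression_cons fs _; exact: IH.
Qed.

(** Along the gallery of an expression, a hyperplane separating its ends is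
    crossed at some letter, and the reflection in it deletes this letter. *)
Lemma gallery_crossing al u g l : W u -> al.1 \in Phi -> expression g l ->
  side al u != side al (amul u g) ->
  exists l1 s l2 g1 g2, [/\ l = l1 ++ s :: l2, fundamental s,
    expression g1 l1, expression g2 l2 &
    amul (arefl al) (amul u g1) = amul (amul u g1) s] /\ g = amul g1 (amul s g2).
Proof.
move=> Wu ra; elim: l u g Wu => [|s l IH] u g Wu eg; first by case: eg => _ ->; rewrite amulg1 eqxx.
have [fs [h eh ->]] := expression_consP eg; rewrite amulA => neq.
have [us|us] := eqVneq (side al u) (side al (amul u s)).
  have [||l1 [t [l2 [g1 [g2 [[-> ft e1 e2 E] ->]]]]]] := IH (amul u s) h _ eh.
  - exact: WM Wu (fundamental_W fs).
  - by rewrite -us.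
  exists (s :: l1), t, l2, (amul s g1), g2; split; last by rewrite !amulA.
  by split=> //; [exact: expression_cons|rewrite !amulA in E *].
exists [::], s, l, aone, h; split; last by rewrite amul1g.
split=> //; rewrite amulg1.
have [be wb sE] := (fundamentalP s).1 fs.
by rewrite sE (side_cross Wu ra wb) // -sE.
Qed.

(** Reflecting [y] in a wall that separates it from the alcove removes exactly
    this wall from the hyperplanes separating them, up to the action of the
    reflection; so the process ends. *)
Lemma move_into_closed_alcove y :
  exists g l, expression g l /\ in_closed_alcove (act g y).
Proof.
have [L LP] := separating_finite y.
(* the number of separating hyperplanes is bounded; the induction is on the bound *)
have [N NP] : exists N, forall M : seq aroot, uniq M ->
    (forall al, al \in M -> [/\ al.1 \in Phi, 0 < aval al c & aval al y < 0]) ->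
    (size M <= N)%N.
  exists (size L) => M uM MP; apply: uniq_leq_size uM _ => al /MP[ra ac ay].
  exact: LP.
elim: N y {L LP} NP => [|N IH] y NP.
  exists aone, [::]; split; first exact: expression_nil.
  rewrite act1; apply: contrapT => /wall_exists[be [wb bc bY]].
  have := NP [:: be] isT; rewrite /= => H; suff: (1 <= 0)%N by [].
  by apply: H => al; rewrite inE => /eqP ->; split=> //; exact: wall_root.
have [Cy|nCy] := pselect (in_closed_alcove y).
  by exists aone, [::]; split; [exact: expression_nil|rewrite act1].
have [be [wb bc bY]] := wall_exists nCy.
have rb := wall_root wb; set s := arefl be; have Ws : W s by exact: W_arefl.
have fs : fundamental s by apply/fundamentalP; exists be.
have [|g [l [eg Cg]]] := IH (act s y); last first.
  exists (amul g s), (l ++ [:: s]); split; last by rewrite act_mul.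
  exact: expression_cat eg (expression1 fs).
move=> M uM MP.
suff : (size (be :: [seq pullback s al | al <- M]) <= N.+1)%N by rewrite /= size_map.
apply: NP.
  rewrite /= map_inj_in_uniq ?uM ?andbT; last first.
    move=> al ga /MP[ra _ _] /MP[rg _ _]; exact: (pullback_inj Ws ra rg).
  apply/negP => /mapP[al /MP[ra ac ay] E].
  have := aval_pullback (act s c) Ws ra.
  by rewrite -E -act_mul areflK // act1 aval_arefl //; lra.
move=> al; rewrite inE => /orP[/eqP ->|/mapP[ga /MP[rg gc gY] ->]] //.
split; first exact: pullback_root.
  rewrite aval_pullback //; have [//|] := boolP (0 < _).
  move=> nsc; have : ga = be \/ ga = aneg be.
    by apply: (wall_separation rg wb Cc); rewrite gc (negPf nsc).
  case=> E; move: gc gY; rewrite E; first by rewrite aval_arefl //; lra.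
  by rewrite aval_neg; lra.
by rewrite aval_pullback.
Qed.

Lemma act_in_alcove g x al : W g -> al.1 \in Phi -> in_alcove x ->
  (0 < aval al (act g x)) = side al g.
Proof.
move=> Wg ra Cx; rewrite /side -!(aval_pullback _ Wg ra).
exact: (alcove_same_side (pullback_root Wg ra)).
Qed.

Lemma expression_inv g l : expression g l -> expression (ainv g) (rev l).
Proof.
elim: l g => [|s l IH] g; first by move=> [_ ->]; split=> //; apply: affine_ext => x;
  rewrite /act /= invmx1 mulmx0 oppr0.
move=> /expression_consP[fs [h eh ->]]; rewrite rev_cons -cats1.
have Wh := expression_W eh; have Ws := fundamental_W fs.
have sK : ainv s = s.
  have [be wb ->] := (fundamentalP s).1 fs.
  exact: (ainv_arefl (wall_root wb)).
rewrite (ainvM Ws Wh) sK.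
exact: expression_cat (IH _ eh) (expression1 fs).
Qed.

(** Every affine reflection is conjugate to the reflection in a wall: the
    gallery from the alcove to its mirror image crosses the hyperplane. *)
Lemma arefl_conjugate al : al.1 \in Phi -> exists g l s,
  [/\ expression g l, fundamental s & arefl al = amul (amul g s) (ainv g)].
Proof.
move=> ra; have Wa : W (arefl al) by exact: W_arefl.
have [g [l [eg Cg]]] := move_into_closed_alcove (act (arefl al) c).
have Wg := expression_W eg; rewrite -act_mul in Cg.
have {}Cg : in_alcove (act (amul g (arefl al)) c).
  by apply: (alcove_intro Cg) => be rb; apply: side_neq0 rb; exact: WM.
have eV := expression_inv eg; have WV' := expression_W eV.
have neq : side al aone != side al (amul aone (ainv g)).
  rewrite amul1g -(act_in_alcove WV' ra Cg) -act_mul amulA (amulVg Wg) amul1g.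
  by rewrite -/(side al _) -[arefl al]amulg1 (side_arefl W1 ra); case: (side _ _).
have [l1 [s [l2 [g1 [g2 [[_ fs e1 _ E] _]]]]]] := gallery_crossing W1 ra eV neq.
exists g1, l1, s; split=> //; rewrite !amul1g in E.
by rewrite -E -amulA (amulgV (expression_W e1)) amulg1.
Qed.

Lemma arefl_expression al : al.1 \in Phi -> exists l, expression (arefl al) l.
Proof.
move=> /arefl_conjugate[g [l [s [eg fs ->]]]].
exists ((l ++ [:: s]) ++ rev l); apply: expression_cat; last exact: expression_inv.
exact: expression_cat eg (expression1 fs).
Qed.

(** The translation by [k e a] is the product of the reflections in [(a, k)] and
    [(a, 0)], so the affine reflections generate the group. *)
Lemma W_expression g : W g -> exists l, expression g l.
Proof.
pose G h := exists l, expression h l.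
have G1 : G aone by exists [::]; exact: expression_nil.
have GM h k : G h -> G k -> G (amul h k).
  by move=> [l1 e1] [l2 e2]; exists (l1 ++ l2); exact: expression_cat.
have Glin A : weyl Phi A -> G (A, 0).
  move=> wA; apply: (weyl_ind (P := fun A => G (A, 0)) _ _ wA) => [//|a B ra _ IH].
  have -> : (refl a *m B, 0) = amul (arefl (a, 0)) (B, 0) :> affine.
    by rewrite /amul /= mul0r scale0r mulmx0 addr0.
  by apply: GM => //; exact: arefl_expression.
have Gtr q : int_comb Phi q -> G (1%:M, e%:R *: q).
  move=> [k ->]; rewrite big_seq; elim/big_rec: _ => [|a x ra IH].
    by rewrite scaler0.
  have -> : (1%:M, e%:R *: (a *~ k a + x)) =
      amul (amul (arefl (a, k a)) (arefl (a, 0))) (1%:M, e%:R *: x) :> affine.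
    apply: affine_ext => y; rewrite !act_mul !act_arefl /act /= !mul1mx.
    rewrite /aval /= pairingBl pairingZl pairing_self ?root_neq0 //.
    rewrite -[a *~ _]scaler_int; set p := pairing _ a.
    by apply/colP => i; rewrite !mxE; ring.
  by apply: (GM) IH; apply: GM; exact: arefl_expression.
case: g => A t [/= wA [q qZ ->]].
have -> : (A, e%:R *: q) = amul (1%:M, e%:R *: q) (A, 0) :> affine.
  by rewrite /amul /= mul1mx mulmx0 add0r.
by apply: GM; [exact: Gtr|exact: Glin].
Qed.

Lemma lenP g : W g -> exists2 l, expression g l & size l = len g.
Proof.
move=> /W_expression[l0 el0]; rewrite /Defs.len; case: xgetP => [k -> [] //|] none.
have ex : exists k, `[< exists2 l, expression g l & size l = k >].
  by exists (size l0); apply/asboolP; exists l0.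
case: (ex_minnP ex) => k /asboolP kP kmin; case: (none k); split=> // l el.
by apply: kmin; apply/asboolP; exists l.
Qed.

Lemma len_min g l : expression g l -> (len g <= size l)%N.
Proof.
move=> eg; rewrite /Defs.len; case: xgetP => [k -> [_ kP]|//]; exact: kP eg.
Qed.

(** * Length and descents *)

(** The gallery of a reduced expression of [g] crosses every hyperplane that
    separates its ends, and there the reflection in it removes a letter. *)
Lemma deletion al g : W g -> al.1 \in Phi -> side al g != side al aone ->
  (len (amul (arefl al) g) < len g)%N.
Proof.
move=> Wg ra neq; have [l el <-] := lenP Wg.
have [|l1 [s [l2 [g1 [g2 [[lE fs e1 e2 E] gE]]]]]] :=
    gallery_crossing W1 ra el.
  by rewrite amul1g eq_sym.
have sK : amul s s = aone.
  have [be wb ->] := (fundamentalP s).1 fs.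
  exact: (areflK (wall_root wb)).
have -> : amul (arefl al) g = amul g1 g2.
  rewrite gE amulA; rewrite !amul1g in E.
  by rewrite E -!amulA (amulA s) sK amul1g.
apply: leq_ltn_trans (len_min (expression_cat e1 e2)) _.
by rewrite lE !size_cat /= addnS.
Qed.

Lemma arefl_mulK al g : al.1 \in Phi -> amul (arefl al) (amul (arefl al) g) = g.
Proof. by move=> ra; rewrite amulA (areflK ra) amul1g. Qed.

Lemma mul_areflK al g : al.1 \in Phi -> amul (amul g (arefl al)) (arefl al) = g.
Proof. by move=> ra; rewrite -amulA (areflK ra) amulg1. Qed.

Lemma len_arefl_gt al g : W g -> al.1 \in Phi -> side al g = side al aone ->
  (len g < len (amul (arefl al) g))%N.
Proof.
move=> Wg ra eqs; rewrite -{1}(arefl_mulK g ra); apply: deletion => //.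
  exact: WM (W_arefl ra) Wg.
by rewrite (side_arefl Wg ra) eqs; case: (side _ _).
Qed.

Lemma len_arefl_lt al g : W g -> al.1 \in Phi ->
  (len (amul (arefl al) g) < len g)%N = (side al g != side al aone).
Proof.
move=> Wg ra; apply/idP/idP; last exact: deletion.
by apply: contraTneq => /(len_arefl_gt Wg ra)/ltnW; rewrite -leqNgt.
Qed.

Lemma len1 : len aone = 0%N.
Proof.
apply/eqP; rewrite -leqn0.
by apply: (len_min (l := [::])); exact: expression_nil.
Qed.

Lemma len_eq0 g : W g -> len g = 0%N -> g = aone.
Proof.
move=> Wg; have [[|s l] [_ gE] <-] := lenP Wg; last by [].
by rewrite gE.
Qed.

Lemma left_descent g : W g -> g <> aone ->
  exists2 be, wall be & (len (amul (arefl be) g) < len g)%N.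
Proof.
move=> Wg ng; have [[|s l] el <-] := lenP Wg.
  by case: el => _ /ng.
have [/fundamentalP[be wb sE] [h eh gE]] := expression_consP el.
exists be => //; rewrite gE sE arefl_mulK ?(wall_root wb) //.
exact: leq_ltn_trans (len_min eh) _.
Qed.

Lemma len_inv g : W g -> len (ainv g) = len g.
Proof.
move=> Wg; suff le h : W h -> (len (ainv h) <= len h)%N.
  by apply/eqP; rewrite eqn_leq le //= -{1}(ainvK Wg) le //; exact: WV.
move=> Wh; have [l el <-] := lenP Wh.
by rewrite -(size_rev l); apply: len_min; exact: expression_inv.
Qed.

Lemma right_descent g : W g -> g <> aone ->
  exists2 be, wall be & (len (amul g (arefl be)) < len g)%N.
Proof.
move=> Wg ng; have WVg := WV Wg.
have [|be wb lt] := left_descent WVg.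
  by move=> E; apply: ng; rewrite -(ainvK Wg) E; apply: (ainv_unique W1); rewrite amul1g.
have rb := wall_root wb; exists be => //; have Wb : W (arefl be) := W_arefl rb.
move: lt; rewrite (len_inv Wg) -(len_inv (WM Wb WVg)) (ainvM Wb WVg).
by rewrite (ainvK Wg) (ainv_arefl rb).
Qed.

Lemma mul_arefl al g : W g -> al.1 \in Phi ->
  amul g (arefl al) = amul (arefl (pullback (ainv g) al)) g.
Proof.
move=> Wg ra; have := arefl_conj (WV Wg) ra.
move=> /(congr1 (fun h => amul (amul g h) g)).
rewrite !amulA (amulgV Wg) amul1g => ->.
by rewrite -!amulA (amulVg Wg) amulg1.
Qed.

Lemma reflectionP (t : affine) :
  reflection Phi Delta e t <-> exists2 al, al.1 \in Phi & t = arefl al.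
Proof.
split=> [[h [s [Wh /fundamentalP[be /wall_root rb ->] ->]]]|[al ra ->]].
  exists (pullback (ainv h) be); first exact: pullback_root (WV Wh) rb.
  by rewrite (mul_arefl Wh rb) -amulA (amulgV Wh) amulg1.
have [g [l [s [eg fs ->]]]] := arefl_conjugate ra.
by exists g, s; split=> //; exact: expression_W eg.
Qed.

(** A left descent of [h] is a wall that separates the alcove of [h] from the
    fundamental one, whereas both closures contain the image of [p]. So this image
    lies on the wall and is fixed by its reflection, and induction applies. In
    particular [h] fixes [p]: the closed alcove is a fundamental domain. *)
Lemma stabilizer_expression h p : W h -> in_closed_alcove p ->
  in_closed_alcove (act h p) ->
  exists2 l, expression h l & forall s, s \in l -> act s p = p.
Proof.
move: {2}(len h) (leqnn (len h)) => N; elim: N h => [|N IH] h lenN Wh Cp Chp.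
  exists [::] => //; rewrite (len_eq0 Wh); first exact: expression_nil.
  by apply/eqP; rewrite -leqn0.
have [->|h1] := pselect (h = aone); first by exists [::] => //; exact: expression_nil.
have [be wb lt] := left_descent Wh h1; have rb := wall_root wb.
have Ws : W (arefl be) := W_arefl rb.
have b0 : aval be (act h p) = 0.
  have rp := pullback_root Wh rb.
  apply/eqP; apply: contraTT lt => b0; rewrite (len_arefl_lt Wh rb) negbK.
  rewrite /side act1 (closed_alcove_same_side rb Cc Chp b0).
  rewrite -!(aval_pullback _ Wh rb) in b0 *.
  by rewrite (closed_alcove_same_side rp Cc Cp b0).
have fixE := arefl_fix b0.
have [||//||l el lP] := IH (amul (arefl be) h).
- by rewrite -ltnS (leq_trans lt).
- exact: WM.
- by rewrite act_mul fixE.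
have hE : act h p = p.
  rewrite -fixE -act_mul; case: el lP => _ -> {IH lt}.
  elim: l => [|s l IHl] lP; first by rewrite act1.
  rewrite /= act_mul IHl ?lP ?mem_head // => t tl.
  by apply: lP; rewrite inE tl orbT.
exists (arefl be :: l).
  rewrite -(arefl_mulK h rb); apply: expression_cons el.
  by apply/fundamentalP; exists be.
by move=> s; rewrite inE => /orP[/eqP ->|/lP //]; rewrite -[in LHS]hE fixE hE.
Qed.

(** * Orders generated by oriented reflections *)

(** An orientation chooses for each hyperplane the affine root that is positive
    on the upper side. *)
Definition orientation (up : aroot -> bool) :=
  forall al, al.1 \in Phi -> up (aneg al) = ~~ up al.

Definition up_step (up : aroot -> bool) u v := W u /\
  exists al, [/\ al.1 \in Phi, up al, ~~ side al u & v = amul (arefl al) u].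

Local Notation up_le up := (clos_refl_trans affine (up_step up)).

Lemma up_step_W up u v : W u -> up_step up u v -> W v.
Proof. by move=> _ [Wu [al [ra _ _ ->]]]; exact: WM (W_arefl ra) Wu. Qed.

Lemma up_step_intro up u al : orientation up -> W u -> al.1 \in Phi ->
  up al != side al u -> up_step up u (amul (arefl al) u).
Proof.
move=> o Wu ra; case upE: (up al) => neq; split=> //.
  by exists al; rewrite upE; split=> //; move: neq; case: (side _ _).
exists (aneg al); rewrite arefl_neg o // upE (side_neg Wu ra).
by split=> //; exact: aneg_root.
Qed.

Lemma up_step_total up u al : orientation up -> W u -> al.1 \in Phi ->
  up_step up u (amul (arefl al) u) \/ up_step up (amul (arefl al) u) u.
Proof.
move=> o Wu ra; have [eqs|neq] := eqVneq (up al) (side al u); last first.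
  by left; exact: up_step_intro.
right; rewrite -{2}(arefl_mulK u ra); apply: up_step_intro => //.
  exact: WM (W_arefl ra) Wu.
by rewrite eqs (side_arefl Wu ra); case: (side _ _).
Qed.

Lemma right_total up be u : orientation up -> be.1 \in Phi -> W u ->
  up_step up u (amul u (arefl be)) \/ up_step up (amul u (arefl be)) u.
Proof.
move=> o rb Wu; rewrite (mul_arefl Wu rb); apply: up_step_total => //.
exact: pullback_root (WV Wu) rb.
Qed.

(** Crossing a wall changes the side with respect to this wall only. *)
Lemma right_homo up be u v : wall be -> W u -> up_step up u v ->
  up_step up (amul u (arefl be)) (amul v (arefl be)) \/ v = amul u (arefl be).
Proof.
move=> wb _ [Wu [al [ra upal su ->]]]; have rb := wall_root wb.
have [us|us] := eqVneq (side al u) (side al (amul u (arefl be))); last first.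
  by right; rewrite (side_cross Wu ra wb us).
left; split; first exact: WM Wu (W_arefl rb).
by exists al; split; rewrite -?us // amulA.
Qed.

Section RightLifting.
Variables (up : aroot -> bool) (be : aroot).
Hypotheses (o : orientation up) (wb : wall be).
Let rb := wall_root wb.
Let rmulK : involutive (fun u => amul u (arefl be)).
Proof. by move=> u; exact: (mul_areflK u rb). Qed.

Lemma right_lift_low u v : up_le up u v -> W u ->
  up_step up u (amul u (arefl be)) -> up_le up u (amul v (arefl be)).
Proof.
move=> uv Wu; exact: (lift_low (@up_step_W up) (fun u => right_total o rb)
  (fun u v => @right_homo up be u v wb) rmulK uv Wu).
Qed.

Lemma right_lift_down u v : up_le up u v -> W u ->
  up_step up (amul u (arefl be)) u ->
  up_le up (amul u (arefl be)) (amul v (arefl be)).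
Proof.
move=> uv Wu; exact: (lift_down (@up_step_W up) (fun u => right_total o rb)
  (fun u v => @right_homo up be u v wb) rmulK uv Wu).
Qed.

Lemma right_lift_up u v : up_le up u v -> W u ->
  up_step up v (amul v (arefl be)) ->
  up_le up (amul u (arefl be)) (amul v (arefl be)).
Proof.
move=> uv Wu; exact: (lift_up (@up_step_W up) (fun u => right_total o rb)
  (fun u v => @right_homo up be u v wb) rmulK uv Wu).
Qed.

End RightLifting.

(** The orientation away from the alcove, which gives the Bruhat order. *)
Definition away al : bool := ~~ side al aone.

Lemma away_orientation : orientation away.
Proof. by move=> al ra; rewrite /away (side_neg W1 ra). Qed.

(** The orientation by positive roots, which gives the linkage order. *)
Definition positive al : bool := al.1 \in pos.

Lemma positive_orientation : orientation positive.
Proof.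
move=> al ra; rewrite /positive /=; apply/idP/idP => [np|].
  by apply: contraL np => /pos_opp.
by have [->|] := pos_total ra.
Qed.

Lemma away_step_len u v : up_step away u v -> (len u < len v)%N.
Proof.
move=> [Wu [al [ra aw su ->]]]; apply: len_arefl_gt => //.
by move: aw su; rewrite /away; case: (side _ _); case: (side _ _).
Qed.

Lemma away_step_intro u al : W u -> al.1 \in Phi ->
  (len u < len (amul (arefl al) u))%N -> up_step away u (amul (arefl al) u).
Proof.
move=> Wu ra lt; apply: up_step_intro => //; first exact: away_orientation.
move: lt; rewrite ltnNge leq_eqVlt negb_or len_arefl_lt //.
by rewrite /away negbK => /andP[_ /eqP ->]; case: (side _ _).
Qed.

Lemma away_le_len u v : up_le away u v -> (len u <= len v)%N.
Proof.
elim=> [x y /away_step_len/ltnW| |x y z _ + _] //; exact: leq_trans.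
Qed.

(** Reflections multiply on the right in the Bruhat order and on the left in
    [up_step]; conjugation exchanges the two forms. *)
Lemma bruhat_up_le u v : W u -> bruhat Phi Delta e u v <-> up_le away u v.
Proof.
move=> Wu; split.
  move=> uv; have [+ _] : up_le away u v /\ W v; last by [].
  elim: uv Wu => {u v} [u v [t rt [-> lt]] Wu|u Wu|u v w _ IHuv _ IHvw Wu].
  - have [al ra tE] := (reflectionP t).1 rt; move: lt.
    rewrite tE (mul_arefl Wu ra) => lt.
    have rp := pullback_root (WV Wu) ra.
    split; last exact: WM (W_arefl rp) Wu.
    exact/rt_step/away_step_intro.
  - by split=> //; exact: rt_refl.
  - by have [uv Wv] := IHuv Wu; have [vw Ww] := IHvw Wv; split=> //; exact: rt_trans uv vw.
elim=> {u v Wu} [u v uv|u|u v w _ uv _ vw];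
  [|exact: rt_refl|exact: rt_trans uv vw].
apply: rt_step; have lt := away_step_len uv; have [Wu [al [ra _ _ vE]]] := uv.
have rp := pullback_root Wu ra.
exists (arefl (pullback u al)).
  by apply/reflectionP; exists (pullback u al).
by split=> //; rewrite (arefl_conj Wu ra).
Qed.

(** Left multiplication by the reflection in a wall preserves the orientation
    away from the alcove, except on that wall. *)
Lemma left_homo be u v : wall be -> W u -> up_step away u v ->
  up_step away (amul (arefl be) u) (amul (arefl be) v) \/ v = amul (arefl be) u.
Proof.
move=> wb _ [Wu [al [ra aw su ->]]]; have rb := wall_root wb.
have Ws : W (arefl be) := W_arefl rb.
have [E|neq] := eqVneq (side al aone) (side al (amul aone (arefl be))); last first.
  right; have := side_cross W1 ra wb neq.
  by rewrite amul1g amulg1 => ->.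
left; have rp := pullback_root Ws ra; split; first exact: WM Ws Wu.
exists (pullback (arefl be) al); split=> //.
- by rewrite /away (side_pullback _ Ws ra) amulg1 -[arefl be]amul1g -E.
- by rewrite (side_pullback _ Ws ra) (arefl_mulK u rb).
- rewrite !amulA; congr amul.
  have := arefl_conj Ws ra => /(congr1 (amul (arefl be))).
  by rewrite arefl_mulK // => ->; rewrite -!amulA (areflK rb) amulg1.
Qed.

Lemma left_lift_down be u v : wall be -> up_le away u v -> W u ->
  up_step away (amul (arefl be) u) u ->
  up_le away (amul (arefl be) u) (amul (arefl be) v).
Proof.
move=> wb uv Wu; have rb := wall_root wb.
apply: (lift_down (@up_step_W away) _ (fun u v => @left_homo be u v wb) _ uv Wu).
  by move=> w Ww; exact: up_step_total away_orientation Ww rb.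
by move=> w; exact: (arefl_mulK w rb).
Qed.

(** * Comparison of the two orders on dominant alcoves *)

Definition dominant g := forall a, a \in pos -> side (a, 0) g.

Lemma awayE al : al.1 \in pos -> away al = (0 < al.2).
Proof.
case: al => a k /= ap; rewrite /away /side /aval /= act1 subr_gt0 -leNgt.
have /andP[c0 c1] := Cc ap; have [k1|k0] := ltP 0 k.
  have : e%:R <= k%:~R * e%:R :> R by rewrite ler_peMl ?ler1z // ltW.
  by lra.
have : k%:~R * e%:R <= 0 :> R by rewrite mulr_le0_ge0 ?lerz0 // ltW.
by move=> ke; apply/negbTE; rewrite -ltNge; lra.
Qed.

(** Inside the dominant chamber only the hyperplanes [(a, k)] with [0 < k] are
    met, and there the two orientations agree. *)
Lemma dominant_side_away u al : dominant u -> al.1 \in pos -> ~~ side al u -> away al.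
Proof.
case: al => a k du /= ap; rewrite awayE //=; apply: contraNT; rewrite -leNgt => k0.
have := du a ap; rewrite /side /aval /= mul0r subr0.
have : k%:~R * e%:R <= 0 :> R by rewrite mulr_le0_ge0 ?lerz0 // ltW.
by lra.
Qed.

Lemma positive_away u v : dominant u -> up_step positive u v -> up_step away u v.
Proof.
move=> du [Wu [al [ra ap su ->]]]; split=> //.
by exists al; split=> //; exact: dominant_side_away ap su.
Qed.

(** Unlike in [positive_away], the upper alcove is the dominant one: if the
    oriented affine root were negative, its opposite would have the upper alcove
    on its negative side. *)
Lemma away_positive u v : dominant v -> up_step away u v -> up_step positive u v.
Proof.
move=> dv [Wu [al [ra aw su vE]]]; split=> //; exists al; split=> //.
rewrite -[positive al]negbK -(positive_orientation ra); apply/negP => ap.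
have Wv : W v by rewrite vE; exact: WM (W_arefl ra) Wu.
have : away (aneg al).
  apply: (dominant_side_away dv ap); rewrite (side_neg Wv ra).
  by rewrite negbK vE (side_arefl Wu ra).
by rewrite (away_orientation ra) aw.
Qed.

(** As [u] is dominant, the hyperplane crossed by the descent, which separates
    the alcove of [u] from the fundamental one, does not pass through the origin. *)
Lemma dominant_descent u be : W u -> dominant u -> wall be ->
  (len (amul u (arefl be)) < len u)%N -> dominant (amul u (arefl be)).
Proof.
move=> Wu du wb lt a ap; have ra := pos_root ap; have sa := du a ap.
have [<- //|neq] := eqVneq (side (a, 0) u) (side (a, 0) (amul u (arefl be))).
have E := side_cross (al := (a, 0)) Wu ra wb neq.
move: lt; rewrite E (len_arefl_lt (al := (a, 0)) Wu ra) sa.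
by have := @awayE (a, 0) ap; rewrite /away /= => /negbFE ->.
Qed.

Lemma right_step u be : W u -> wall be ->
  (len (amul u (arefl be)) < len u)%N -> up_step away (amul u (arefl be)) u.
Proof.
move=> Wu wb lt; have [/(away_step_len)|//] :=
  right_total away_orientation (wall_root wb) Wu.
by rewrite ltnNge (ltnW lt).
Qed.

Lemma bruhat_linkage u v : W u -> W v -> dominant u -> dominant v ->
  up_le away u v -> up_le positive u v.
Proof.
move: {2}(len v) (leqnn (len v)) => N; elim: N u v => [|N IH] u v lenN Wu Wv du dv uv.
  have v1 : v = aone by apply: (len_eq0 Wv); apply/eqP; rewrite -leqn0.
  have := away_le_len uv; rewrite {1}v1 len1 leqn0 => /eqP u0.
  by rewrite v1 (len_eq0 Wu u0); exact: rt_refl.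
have [v1|v1] := pselect (v = aone).
  by apply: IH; rewrite // v1 len1.
have [be wb lt] := right_descent Wv v1; have rb := wall_root wb.
have Wb : W (arefl be) := W_arefl rb.
have sv := right_step Wv wb lt.
have dvs := dominant_descent Wv dv wb lt; have Wvs := WM Wv Wb.
have lvs : (len (amul v (arefl be)) <= N)%N by rewrite -ltnS (leq_trans lt).
have [us|su] := right_total away_orientation rb Wu.
  have uvs := right_lift_low away_orientation wb uv Wu us.
  exact: rt_trans (IH _ _ lvs Wu Wvs du dvs uvs) (rt_step _ _ _ _ (away_positive dv sv)).
have Wus := WM Wu Wb.
have dus := dominant_descent Wu du wb (away_step_len su).
have usvs := right_lift_down away_orientation wb uv Wu su.
have usvs' := IH _ _ lvs Wus Wvs dus dvs usvs.
have vK : amul (amul v (arefl be)) (arefl be) = v by exact: mul_areflK.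
have uK : amul (amul u (arefl be)) (arefl be) = u by exact: mul_areflK.
rewrite -vK -uK; apply: (right_lift_up positive_orientation wb usvs' Wus).
by rewrite vK; exact: away_positive.
Qed.

(** Translations by multiples of [2 e rho], deep in the dominant chamber. *)
Definition deep (N : nat) : affine := (1%:M, e%:R *: ((2 *: rho) *+ N)).

Lemma deep_W N : W (deep N).
Proof.
split; first exact: weyl1.
exists ((2 *: rho) *+ N) => //.
exact: (int_combMz N rho2_int).
Qed.

Lemma pairing_deep N x a :
  pairing (act (deep N) x) a = pairing x a + e%:R * (N%:R * (2 * pairing rho a)).
Proof.
by rewrite /act /= mul1mx pairingDl pairingZl -[_ *+ N]scaler_nat !pairingZl.
Qed.

Lemma pairing_deep_inv N x a :
  pairing (act (ainv (deep N)) x) a = pairing x a - e%:R * (N%:R * (2 * pairing rho a)).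
Proof. by rewrite -{2}(actKV x (deep_W N)) pairing_deep addrK. Qed.

Lemma deep_dominant u : exists N0, forall N, (N0 <= N)%N -> dominant (amul (deep N) u).
Proof.
suff [N0 N0P] : exists N0, forall N, (N0 <= N)%N -> forall a, a \in pos ->
    0 < pairing (act (deep N) (act u c)) a.
  exists N0 => N NN0 a ap; rewrite /side /aval /= mul0r subr0 act_mul.
  exact: N0P.
elim: pos (@pairing_rho_pos) => [|b s IH] rhoP; first by exists 0%N.
have [|N1 N1P] := IH; first by move=> a as_; apply: rhoP; rewrite inE as_ orbT.
have b0 := rhoP _ (mem_head _ _).
pose N2 := (Num.truncn (`|pairing (act u c) b| / pairing rho b)).+1.
exists (maxn N1 N2) => N; rewrite geq_max => /andP[NN1 NN2] a.
rewrite inE => /orP[/eqP ->|]; last exact: N1P.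
rewrite pairing_deep.
have : `|pairing (act u c) b| < N%:R * pairing rho b.
  rewrite -ltr_pdivrMr // (lt_le_trans (truncnS_gt _)) // ler_nat.
  exact: NN2.
have := ler_norm (- pairing (act u c) b); rewrite normrN => h1 h2.
have N0 : 0 <= N%:R * pairing rho b by rewrite mulr_ge0 // ltW.
have e1 : 1 <= e%:R :> R by rewrite ler1n.
have -> : e%:R * (N%:R * (2 * pairing rho b)) = 2 * (e%:R * (N%:R * pairing rho b)) by ring.
have : N%:R * pairing rho b <= e%:R * (N%:R * pairing rho b) by rewrite ler_peMl.
by lra.
Qed.

Lemma deep_step N u v : up_step positive u v ->
  up_step positive (amul (deep N) u) (amul (deep N) v).
Proof.
move=> [Wu [al [ra ap su ->]]]; have Wd := deep_W N; have WVd := WV Wd.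
have rp := pullback_root WVd ra.
split; first exact: WM Wd Wu.
have dK x : act (ainv (deep N)) (act (deep N) x) = x by exact: (actVK x Wd).
exists (pullback (ainv (deep N)) al); split=> //.
- by rewrite /positive /= invmx1 trmx1 mul1mx.
- by rewrite (side_pullback _ WVd ra) amulA (amulVg Wd) amul1g.
- by rewrite !amulA -(mul_arefl Wd ra).
Qed.

(** Translations preserve the linear part of an affine root, hence also the steps
    of the linkage order. *)
Lemma linkage_deep u v : up_le positive u v ->
  exists N0, forall N, (N0 <= N)%N -> up_le away (amul (deep N) u) (amul (deep N) v).
Proof.
elim=> {u v} [u v uv|u|u v w _ [N1 P1] _ [N2 P2]].
- have [N0 N0P] := deep_dominant u; exists N0 => N /N0P dN.
  exact: rt_step (positive_away dN (deep_step N uv)).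
- by exists 0%N => N _; exact: rt_refl.
- exists (maxn N1 N2) => N; rewrite geq_max => /andP[/P1 uv /P2 vw].
  exact: rt_trans uv vw.
Qed.

(** If no hyperplane separates the alcove both from that of [ainv u] and from that
    of [v], the lengths of [u] and [v] add up. Each letter of a reduced expression
    of [u] then is an ascent where it acts, and the lifting property on the left
    cancels it. *)
Lemma left_cancel u v w : W u -> W v ->
  (forall al, al.1 \in Phi -> side al (ainv u) != side al aone ->
    side al v = side al aone) ->
  up_le away (amul u v) (amul u w) -> up_le away v w.
Proof.
move: {2}(len u) (leqnn (len u)) => N; elim: N u => [|N IH] u lenN Wu Wv sep uvw.
  move: uvw; rewrite (len_eq0 Wu) ?amul1g //.
  by apply/eqP; rewrite -leqn0.
have [u1|u1] := pselect (u = aone); first by move: uvw; rewrite u1 !amul1g.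
have [be wb lt] := left_descent Wu u1; have rb := wall_root wb.
have Ws : W (arefl be) := W_arefl rb.
set u' := amul (arefl be) u; have Wu' : W u' := WM Ws Wu.
have WVu := WV Wu.
have uE : u = amul (arefl be) u' by rewrite /u' arefl_mulK.
have u'V : ainv u' = amul (ainv u) (arefl be).
  by rewrite (ainvM Ws Wu) (ainv_arefl rb).
have sbe : side be u != side be aone by rewrite -(len_arefl_lt Wu rb).
have sbe' : side be u' = side be aone.
  rewrite (side_arefl Wu rb).
  by move: sbe; case: (side _ _); case: (side _ _).
have sep' al : al.1 \in Phi -> side al (ainv u') != side al aone ->
    side al v = side al aone.
  move=> ra; have [eqs neq|neq _] := eqVneq (side al (ainv u)) (side al aone); last exact: sep.
  have {}neq : side al (ainv u) != side al (amul (ainv u) (arefl be)).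
    by rewrite eqs -u'V eq_sym.
  have E := side_cross WVu ra wb neq.
  have := len_arefl_gt WVu ra eqs.
  by rewrite -E -u'V !(len_inv) // ltnNge (ltnW lt).
have suv : side be (amul u' v) = side be aone.
  (* the preimage of this wall under [u'] separates the alcove from [ainv u] *)
  have rp := pullback_root Wu' rb.
  have := sep (pullback u' be) rp; rewrite !(side_pullback _ Wu' rb) amulg1 sbe'.
  apply; rewrite /u' -amulA (amulgV Wu) (side_arefl W1 rb).
  by case: (side _ _).
have Wu'v := WM Wu' Wv.
apply: (IH u') => //; first by rewrite -ltnS (leq_trans lt).
have := left_lift_down wb uvw (WM Wu Wv).
rewrite !amulA -/u'; apply; rewrite uE -amulA.
apply: (up_step_intro away_orientation) => //.
by rewrite suv /away; case: (side _ _).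
Qed.

(** The alcove of the inverse of a dominant translation is separated from the
    fundamental one only by hyperplanes [(a, k)] with [a] positive and [k <= 0], and
    a dominant alcove only by those with [0 < k]. *)
Lemma linkage_bruhat u v : W u -> dominant u -> up_le positive u v -> up_le away u v.
Proof.
move=> Wu du /linkage_deep[N /(_ N (leqnn N))]; apply: left_cancel (deep_W N) (Wu) _ => al.
have Wd := WV (deep_W N).
have main be : be.1 \in pos -> side be (ainv (deep N)) != side be aone ->
    side be u = side be aone.
  case: be => a k /= ap; have := @awayE (a, k) ap; rewrite /away /=.
  have [k1 /negbTE ->|k0 /negbFE -> _] := ltP 0 k.
    rewrite eqbF_neg negbK /side /aval /= pairing_deep_inv.
    have /andP[c0 c1] := Cc ap; have := pairing_rho_pos ap => r0.
    have : e%:R <= k%:~R * e%:R :> R by rewrite ler_peMl ?ler1z // ltW.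
    have : 0 <= e%:R * (N%:R * (2 * pairing rho a)) by rewrite !mulr_ge0 // ltW.
    move: (e%:R * (_ * _)) (k%:~R * e%:R) => p q p0 qe lt; exfalso.
    by move: c0 c1 p0 qe lt; lra.
  have := @dominant_side_away u (a, k) du ap; rewrite awayE //= ltNge k0 /=.
  by case: (side _ _) => // /(_ isT).
move=> ra; have [/main //|/(main (aneg al))] := pos_total ra.
rewrite !(side_neg _ ra) //; last exact: W1.
by move=> H neq; apply: negb_inj; apply: H; rewrite (inj_eq negb_inj).
Qed.

(** * Linkage of weights *)

(** It is enough to test generators, as the root lattice is stable under the
    Weyl group. Both weights and [rho] satisfy the hypothesis. *)
Lemma weyl_moves_in_lattice (A : 'M[R]_n) x : weyl Phi A ->
  (forall a, a \in Phi -> int_comb Phi (refl a *m x - x)) ->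
  int_comb Phi (A *m x - x).
Proof.
move=> wA xP; apply: (weyl_ind (P := fun A => int_comb Phi (A *m x - x)) _ _ wA).
  by rewrite mul1mx subrr; exact: int_comb0.
move=> a B ra _ IH.
have -> : refl a *m B *m x - x = refl a *m (B *m x - x) + (refl a *m x - x).
  by rewrite mulmxBr mulmxA addrA subrK.
by apply: int_combD (xP a ra); exact: (int_comb_refl IH ra).
Qed.

Lemma dot_act_lattice g x : W g -> weight Phi x ->
  int_comb Phi (dot_act Phi Delta g x - x).
Proof.
move=> [wA [q qZ tE]] wx; rewrite /dot_act mulmxDr tE.
have -> : g.1 *m x + g.1 *m rho - rho + e%:R *: q - x =
    (g.1 *m x - x) + (g.1 *m rho - rho) + q *~ e.
  rewrite -[q *~ _]scaler_int; apply/colP => i; rewrite !mxE; ring.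
apply: int_combD; last exact: int_combMz.
apply: int_combD; apply: weyl_moves_in_lattice => // a ra.
  have /intrP[k kE] := wx a ra.
  rewrite reflE addrC addKr kE scaler_int; apply/int_combN/int_combMz.
  exact: int_comb_mem root_uniq ra.
by rewrite -opprB; apply/int_combN/rho_refl_int.
Qed.

Lemma weight_shift x y : weight Phi x -> int_comb Phi (y - x) -> weight Phi y.
Proof.
move=> wx yx a ra; rewrite -[y](subrK x) pairingDl rpredD //; last exact: wx.
exact: (int_comb_pairing yx ra).
Qed.

Lemma moves_toP mu g : moves_to mu g <->
  W g /\ exists2 p, in_closed_alcove p & act g p = mu + rho.
Proof.
split=> [[Wg [x clx gx]]|[Wg [p Cp gp]]]; split=> //.
  exists (x + rho); first exact/closure_alcoveP.
  by rewrite -gx dot_act_shift.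
exists (p - rho); first by apply/closure_alcoveP; rewrite subrK.
by apply: (addIr rho); rewrite dot_act_shift subrK.
Qed.

Lemma minimal_moverP mu : moves_to mu (minimal_mover Phi Delta e mu) /\
  forall h, moves_to mu h -> (len (minimal_mover Phi Delta e mu) <= len h)%N.
Proof.
rewrite /minimal_mover; case: xgetP => [g -> //|none]; exfalso.
have [g [l [eg Cg]]] := move_into_closed_alcove (mu + rho).
have Wg := expression_W eg.
have ex : exists k, `[< exists2 h, moves_to mu h & len h = k >].
  exists (len (ainv g)); apply/asboolP; exists (ainv g) => //.
  apply/moves_toP; split; first exact: WV.
  by exists (act g (mu + rho)) => //; exact: (actVK _ Wg).
case: (ex_minnP ex) => k /asboolP[h hmu hk] kmin; apply: (none h); split=> // h' h'mu.
by rewrite hk; apply: kmin; apply/asboolP; exists h'.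
Qed.

Lemma dominant_mover g p : W g -> in_closed_alcove p ->
  (forall a, a \in pos -> 0 < pairing (act g p) a) -> dominant g.
Proof.
move=> Wg Cp gp a ap; have ra := pos_root ap.
have rp := pullback_root (al := (a, 0)) Wg ra.
have v0 : 0 < aval (a, 0) (act g p) by rewrite /aval /= mul0r subr0 gp.
rewrite -(aval_pullback (al := (a, 0)) _ Wg ra) in v0.
rewrite /side -(aval_pullback (al := (a, 0)) _ Wg ra).
by rewrite (closed_alcove_same_side rp Cc Cp) ?gt_eqF.
Qed.

(** A point [act g p] off a hyperplane lies on the same side of it as the alcove
    of [g], whose closure contains the point. *)
Lemma side_closed g p al : W g -> in_closed_alcove p -> al.1 \in Phi ->
  aval al (act g p) != 0 -> side al g = (0 < aval al (act g p)).
Proof.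
move=> Wg Cp ra; have rp := pullback_root Wg ra.
rewrite /side -!(aval_pullback _ Wg ra) => v0.
exact: (closed_alcove_same_side rp Cc Cp v0).
Qed.

Lemma dominance_dot_rho x y : dominance Phi Delta x y -> 0 <= dot rho (y - x).
Proof.
move=> [k ->]; rewrite dotC dot_suml big_seq sumr_ge0 // => a ap.
rewrite -scaler_nat dotZl dotC mulr_ge0 //.
exact/ltW/dot_rho_pos.
Qed.

(** Every step up of a point of the orbit is induced by a step up of the
    alcove, or does not move the point. *)
Lemma linked_up_lift x y g p : in_closed_alcove p -> linked_up Phi Delta e x y ->
  W g -> act g p = x + rho ->
  exists h, [/\ W h, up_le positive g h & act h p = y + rho].
Proof.
move=> Cp xy; elim: xy g => {x y} [x y [_ _ xy [s sr sx]]|x|x y z _ IH1 _ IH2] g Wg gp.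
- have [al ra [ap sE]] : exists2 al, al.1 \in Phi & al.1 \in pos /\ s = arefl al.
    have [al ra ->] := (reflectionP s).1 sr.
    have [ap|ap] := pos_total ra; first by exists al.
    by exists (aneg al); [exact: aneg_root|rewrite arefl_neg].
  have yE : y + rho = act (arefl al) (act g p).
    by rewrite gp -sx dot_act_shift sE.
  have le0 : aval al (act g p) <= 0.
    have := dominance_dot_rho xy.
    have -> : y - x = (y + rho) - (x + rho) by rewrite opprD addrACA subrr addr0.
    rewrite yE -gp act_arefl addrAC subrr add0r dotNr dotZr oppr_ge0.
    by rewrite pmulr_lle0 // dot_rho_pos.
  have [v0|v0] := eqVneq (aval al (act g p)) 0.
    by exists g; split=> //; [exact: rt_refl|rewrite yE arefl_fix].
  exists (amul (arefl al) g); split; first exact: WM (W_arefl ra) Wg.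
    apply: rt_step; split=> //; exists al; split=> //.
    by rewrite (side_closed Wg Cp ra v0) -leNgt.
  by rewrite act_mul yE.
- by exists g; split=> //; exact: rt_refl.
- have [h [Wh gh hp]] := IH1 g Wg gp; have [k [Wk hk kp]] := IH2 h Wh hp.
  by exists k; split=> //; exact: rt_trans gh hk.
Qed.

(** All points of the orbit of [p] differ from [mu + rho] by elements of the root
    lattice. So a step up moves a point by a multiple of a positive root that lies
    in the root lattice, hence upward in the dominance order. *)
Lemma linked_up_project mu g h k p : in_closed_alcove p -> weight Phi mu -> W k ->
  act k p = mu + rho -> W g -> up_le positive g h ->
  linked_up Phi Delta e (act g p - rho) (act h p - rho).
Proof.
move=> Cp wmu Wk kp Wg gh.
have lattice u : W u -> int_comb Phi ((act u p - rho) - mu).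
  move=> Wu; have Wuk := WM Wu (WV Wk).
  have := dot_act_lattice Wuk wmu; congr (int_comb _ (_ - _)).
  apply: (addIr rho); rewrite dot_act_shift subrK act_mul -kp.
  by rewrite (actVK _ Wk).
elim: gh Wg => {g h} [g h [_ [al [ra ap sg ->]]] Wg|g Wg|g h k' gh IH1 _ IH2 Wg].
- have Wa : W (arefl al) := W_arefl ra; have Wh := WM Wa Wg.
  have lg := lattice _ Wg; have lh := lattice _ Wh.
  have le0 : aval al (act g p) <= 0.
    rewrite leNgt; apply: contraNN sg => gt0.
    by rewrite (side_closed Wg Cp ra) // gt_eqF.
  apply: rt_step; split; try exact: (weight_shift wmu).
    apply: (dominance_scale (a := al.1) (c := - aval al (act g p))) => //.
    - by rewrite oppr_ge0.
    - by rewrite opprB addrA subrK act_mul act_arefl addrAC subrr add0r scaleNr.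
    - have := int_combB lh lg; congr int_comb.
      by rewrite [- (_ - mu)]opprB addrA subrK.
  exists (arefl al); first by apply/reflectionP; exists al.
  by apply: (addIr rho); rewrite dot_act_shift !subrK act_mul.
- exact: rt_refl.
- apply: rt_trans (IH1 Wg) (IH2 _).
  exact: (le_dom (@up_step_W positive) gh Wg).
Qed.

(** By minimality of [g], no reflection fixing [p] gives a descent of [g] on the
    right; so the lifting property keeps [g] below while the right factor moves
    along the letters of [s], up or down. *)
Lemma below_coset g h l s p : W g -> W h -> up_le away g h ->
  (forall k, W k -> act k p = act g p -> (len g <= len k)%N) ->
  expression s l -> (forall t, t \in l -> act t p = p) -> up_le away g (amul h s).
Proof.
move=> Wg Wh gh gmin; elim: l s h Wh gh => [|t l IH] s h Wh gh es lP.
  by case: es => _ ->; rewrite amulg1.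
have [ft [k ek ->]] := expression_consP es.
have [be wb tE] := (fundamentalP t).1 ft.
have tp : act t p = p by apply: lP; rewrite mem_head.
have rb := wall_root wb; have Wt : W t by rewrite tE; exact: W_arefl.
rewrite amulA; apply: IH ek _ => [||t' t'l]; first exact: WM.
  rewrite tE; apply: (right_lift_low away_orientation wb gh Wg).
  have [//|/away_step_len] := right_total away_orientation rb Wg.
  rewrite ltnNge gmin //; first by rewrite -tE; exact: WM.
  by rewrite act_mul -tE tp.
by apply: lP; rewrite inE t'l orbT.
Qed.

Lemma linkage_iff_bruhat mu nu : dominant_weight Phi Delta mu ->
  dominant_weight Phi Delta nu -> same_orbit Phi Delta e mu nu ->
  linked_up Phi Delta e mu nu <->
  bruhat Phi Delta e (minimal_mover Phi Delta e mu) (minimal_mover Phi Delta e nu).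
Proof.
move=> [wmu dmu] [_ dnu] [g0 Wg0 g0E].
have [/moves_toP[] + + +] := minimal_moverP mu.
have [/moves_toP[] + + +] := minimal_moverP nu.
move: (minimal_mover _ _ _ mu) (minimal_mover _ _ _ nu) => f f'.
move=> Wf' [p' Cp' f'p'] minf' Wf [p Cp fp] minf.
have reg x : (forall a, a \in pos -> 0 <= pairing x a) ->
    forall a, a \in pos -> 0 < pairing (x + rho) a.
  move=> dx a ap; rewrite pairingDl ltr_wpDl ?dx //.
  exact: pairing_rho_pos.
have df : dominant f by apply: (dominant_mover Wf Cp) => a; rewrite fp; exact: reg.
have df' : dominant f' by apply: (dominant_mover Wf' Cp') => a; rewrite f'p'; exact: reg.
have orbit_pp' k : W k -> act k p = p' -> p = p'.
  move=> Wk kp; have Ckp : in_closed_alcove (act k p) by rewrite kp.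
  have [l [_ kE] lP] := stabilizer_expression Wk Cp Ckp.
  rewrite -kp kE; elim: l lP {kE} => [|t l IH] lP; first by rewrite act1.
  rewrite /= act_mul -IH ?lP ?mem_head // => s sl.
  by apply: lP; rewrite inE sl orbT.
have pE : p = p'.
  apply: (orbit_pp' (amul (ainv f') (amul g0 f))).
    exact: WM (WV Wf') (WM Wg0 Wf).
  rewrite !act_mul fp -dot_act_shift g0E -f'p'.
  exact: (actVK _ Wf').
subst p'; rewrite (bruhat_up_le _ Wf); split=> [munu|ff'].
  have [v [Wv fv vp]] := linked_up_lift Cp munu Wf fp.
  have dv : dominant v by apply: (dominant_mover Wv Cp) => a; rewrite vp; exact: reg.
  have bfv := linkage_bruhat Wf df fv.
  have Wk := WM (WV Wv) Wf'.
  have kp : act (amul (ainv v) f') p = p.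
    by rewrite act_mul f'p' -vp; exact: (actVK _ Wv).
  have Ckp : in_closed_alcove (act (amul (ainv v) f') p) by rewrite kp.
  have [l el lP] := stabilizer_expression Wk Cp Ckp.
  have -> : f' = amul v (amul (ainv v) f') by rewrite amulA (amulgV Wv) amul1g.
  apply: (below_coset Wf Wv bfv _ el lP) => k Wk' kpf; apply: minf.
  by apply/moves_toP; split=> //; exists p; rewrite // kpf.
have := bruhat_linkage Wf Wf' df df' ff'.
move=> /(linked_up_project Cp wmu Wf fp Wf).
by rewrite fp f'p' !addrK.
Qed.

End AffineWeylGroup.

Theorem theorem9p6 (R : realType) (n : nat) (Phi Delta : seq 'cV[R]_n)
    (hPhi : root_system Phi) (hirr : irreducible_roots Phi)
    (hDelta : is_base Phi Delta)
    (e : nat) (he : (0 < e)%N) (mu nu : 'cV[R]_n)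
    (hmu : dominant_weight Phi Delta mu) (hnu : dominant_weight Phi Delta nu)
    (horb : same_orbit Phi Delta e mu nu) :
  linked_up Phi Delta e mu nu <->
  bruhat Phi Delta e (minimal_mover Phi Delta e mu)
                     (minimal_mover Phi Delta e nu).
Proof.
have [c Cc] := alcove_nonempty hPhi hDelta he.
exact: (linkage_iff_bruhat hPhi hDelta he Cc hmu hnu horb).
Qed.
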